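(* Let $\mathbf m_1^{\mathrm{ini}},\dots,\mathbf m_4^{\mathrm{ini}}\in\mathbb R^3$ be the initial positions of four microphones mounted on a vehicle that can take positions in the same way as a hovering drone, and assume these four points do not lie on a common plane. Let $\mathbf L\in\mathbb R^3$ be the fixed position of a loudspeaker, and let $\mathcal W$ be a set of $n$ walls at fixed positions in $\mathbb R^3$. The set of vehicle positions is the group $G$ of dimension $4$ described in the context (rotations about vertical axes and arbitrary translations in $\mathbb R^3$). (i) If the microphones are not deceived by an unlucky stack of mirror points, then almost all vehicle positions are good; that is, the set of vehicle positions $\phi\in G$ that are not good is contained in a subvariety of $G$ of dimension strictly less than $4=\dim G$. (ii) Moreover, let $l\in\{2,3,4\}$ be the number of distinct $z$-coordinates of the four microphone positions. Then within the $(3n)$-dimensional configuration space of all arrangements of $n$ walls (with $\mathbf L$ and the microphone configuration fixed), the arrangements for which an unlucky stack of mirror points occurs are contained in a subvariety of codimension $3(l-1)$ (for $n<l$ this is read as saying that no such arrangement exists).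
   Context: **Vehicle positions.** $G$ is the group of all maps $\phi:\mathbb R^3\to\mathbb R^3$ of the form $$\phi(v)=\begin{pmatrix} a_{1,1}&a_{1,2}&0\\ a_{2,1}&a_{2,2}&0\\ 0&0&1\end{pmatrix}v+\begin{pmatrix} a_{1,3}\\ a_{2,3}\\ a_{3,3}\end{pmatrix},\qquad a_{i,j}\in\mathbb R,$$ with $\begin{pmatrix} a_{1,1}&a_{1,2}\\ a_{2,1}&a_{2,2}\end{pmatrix}$ orthogonal of determinant $1$. It is regarded as an affine variety in $\mathbb R^7$ via the coordinates $a_{i,j}$. In the vehicle position $\phi$ the microphones are at $\mathbf m_i=\phi(\mathbf m_i^{\mathrm{ini}})$, $i=1,\dots,4$. **Walls and mirror points.** A wall is a plane surface, identified with the plane in $\mathbb R^3$ containing it. For a wall $W$, its mirror point is $\mathrm{ref}_W(\mathbf L)$, the reflection of $\mathbf L$ at the plane $W$. Walls are identified through their mirror points (a point $\mathbf s\neq\mathbf L$ is the mirror point of exactly one plane). The configuration space of arrangements of $n$ walls is the space of $n$-tuples of mirror points, viewed in $(\mathbb R^3)^n$. **Echoes.** Only first-order echoes are considered, ray acoustics is used, and all measurements are exact. For a vehicle position $\phi$ and $i\in\{1,\dots,4\}$, let $\mathcal H_i(\phi)\subseteq\mathcal W$ be the set of walls whose first-order echo is heard by microphone $i$; these sets are arbitrary. The echo of $W$ travels the distance $\lVert\mathrm{ref}_W(\mathbf L)-\mathbf m_i\rVert$ to microphone $i$, so the measured data are the sets $$\mathcal D_i=\{\lVert\mathrm{ref}_W(\mathbf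 L)-\mathbf m_i\rVert^2 : W\in\mathcal H_i(\phi)\},\quad i=1,\dots,4,$$ without information on which wall a value comes from. **Wall detection algorithm.** Let $D_{i,j}=\lVert\mathbf m_i-\mathbf m_j\rVert^2$ and define $$f_D(u_1,\dots,u_4)=\det\begin{pmatrix}0&u_1&\cdots&u_4&1\\ u_1&D_{1,1}&\cdots&D_{1,4}&1\\ \vdots&\vdots&&\vdots&\vdots\\ u_4&D_{4,1}&\cdots&D_{4,4}&1\\ 1&1&\cdots&1&0\end{pmatrix}.$$ For every $(d_1,\dots,d_4)\in\mathcal D_1\times\cdots\times\mathcal D_4$ with $f_D(d_1,\dots,d_4)=0$, the algorithm outputs the wall whose mirror point is the unique point $\mathbf s\in\mathbb R^3$ with $\lVert\mathbf s-\mathbf m_i\rVert^2=d_i$ for $i=1,\dots,4$. A wall is called detected if it is output by the algorithm. A ghost wall is a detected wall that does not exist, i.e. an output whose point $\mathbf s$ is not equal to $\mathrm{ref}_W(\mathbf L)$ for any $W\in\mathcal W$. **Good positions.** A vehicle position is bad if at least one ghost wall is detected. It is good if every wall whose echo is heard by all four microphones is detected and no ghost wall is detected. **Unlucky stacks.** The microphones are deceived by an unlucky stack of mirror points (equivalently, an unlucky stack of mirror points occurs) if there are four, not necessarily distinct, walls in $\mathcal W$ whose mirror points $\mathbf s_1,\dots,\mathbf s_4$ lie on a common vertical line (parallel to the $z$-axis) and such that for all $i,j\in\{1,\dots,4\}$ the $z$-coordinate of $\mathbf s_j-\mathbf s_i$ is twice the $z$-coordinate of $\mathbf m_j-\mathbf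 m_i$ (this does not depend on the vehicle position). *)

(* Defs.v *)
From mathcomp Require Import all_boot all_order all_algebra.
From mathcomp Require Import mpoly.
From mathcomp Require Import boolp classical_sets functions cardinality reals.

Set Implicit Arguments.
Unset Strict Implicit.
Unset Printing Implicit Defensive.

Import Order.TTheory GRing.Theory Num.Theory.

Local Open Scope classical_set_scope.
Local Open Scope ring_scope.

Section AffineVarieties.
Variables (R : realType) (N : nat).
Implicit Types (X Z V : set 'rV[R]_N).

Definition zariski_closed Z : Prop :=
  exists I : set {mpoly R[N]},
    Z = [set x | forall p, I p -> p.@[fun i => x 0 i] = 0].

(* As for topological spaces, the empty set is not irreducible. *)
Definition irreducible Z : Prop :=
  Z !=set0 /\
  forall A B, zariski_closed A -> zariski_closed B ->
    Z `<=` A `|` B -> Z `<=` A \/ Z `<=` B.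

(* Z_0 < Z_1 < ... < Z_k, irreducible closed subsets of X. *)
Definition has_chain X (k : nat) : Prop :=
  exists Z : nat -> set 'rV[R]_N,
    (forall i, (i <= k)%N ->
       [/\ zariski_closed (Z i), irreducible (Z i) & Z i `<=` X]) /\
    (forall i, (i < k)%N -> Z i `<` Z i.+1).

(* Krull dimension in the Zariski topology. *)
Definition has_dim X (d : nat) : Prop :=
  has_chain X d /\ forall k, has_chain X k -> (k <= d)%N.

(* Unlike [has_dim], this also covers the empty variety (dimension < 0). *)
Definition dim_lt X (d : nat) : Prop :=
  forall k, has_chain X k -> (k < d)%N.

Definition has_codim V X (c : nat) : Prop :=
  exists d e, [/\ has_dim V d, has_dim X e & (d + c)%N = e].

End AffineVarieties.

Section Geometry.
Variable R : realType.
Implicit Types (u v s x y : 'cV[R]_3) (W P : set 'cV[R]_3).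

Definition dotv u v : R := \sum_i u i 0 * v i 0.

Definition sqdist u v : R := dotv (u - v) (u - v).

Definition zcoord v : R := v ord_max 0.

Definition e_z : 'cV[R]_3 := delta_mx ord_max 0.

Definition is_plane P : Prop :=
  exists (a : 'cV[R]_3) (c : R), a != 0 /\ P = [set x | dotv a x = c].

(* The midpoint of x and y lies on P, and y - x is orthogonal to P. *)
Definition is_reflection P x y : Prop :=
  P (2^-1 *: (x + y)) /\
  forall p q, P p -> P q -> dotv (y - x) (p - q) = 0.

(* When P is a plane, the point y is unique; otherwise the value is
   irrelevant. *)
Definition reflection P x : 'cV[R]_3 := xget x [set y | is_reflection P x y].

Definition coplanar (m : 'I_4 -> 'cV[R]_3) : Prop :=
  exists2 P, is_plane P & forall i, P (m i).

Definition num_heights (m : 'I_4 -> 'cV[R]_3) : nat :=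
  size (undup [seq zcoord (m i) | i : 'I_4]).

End Geometry.

(* A vehicle position is given by its coordinates
   (a11, a12, a21, a22, a13, a23, a33) in R^7 (2 * 2 + 3 computes to 7). *)
Section VehiclePositions.
Variable R : realType.
Implicit Type a : 'rV[R]_(2 * 2 + 3).

Definition rotation_part a : 'M[R]_2 := vec_mx (lsubmx a).

Definition translation_part a : 'cV[R]_3 := (rsubmx a)^T.

Definition vehicle_map a (v : 'cV[R]_3) : 'cV[R]_3 :=
  (block_mx (rotation_part a) 0 0 1%:M : 'M[R]_(2 + 1)) *m v
  + translation_part a.

Definition vehicle_positions : set 'rV[R]_(2 * 2 + 3) :=
  [set a | rotation_part a *m (rotation_part a)^T = 1%:M
           /\ \det (rotation_part a) = 1].

End VehiclePositions.

Section WallDetection.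
Variables (R : realType) (L : 'cV[R]_3).

(* In this section m is the tuple of actual microphone positions, and
   heard i is the set of walls whose echo is heard by microphone i. *)
Implicit Types (m : 'I_4 -> 'cV[R]_3) (heard : 'I_4 -> set (set 'cV[R]_3)).
Implicit Types (walls : set (set 'cV[R]_3)) (s : 'cV[R]_3).

Definition mirror (W : set 'cV[R]_3) : 'cV[R]_3 := reflection W L.

Definition data m heard (i : 'I_4) : set R :=
  [set sqdist (mirror W) (m i) | W in heard i].

Definition f_D m (u : 'I_4 -> R) : R :=
  \det (block_mx
          (0 : 'M_1) (row_mx (\row_i u i) (const_mx 1 : 'M_1))
          (col_mx (\col_i u i) (const_mx 1 : 'M_1))
          (block_mx (\matrix_(i, j) sqdist (m i) (m j)) (const_mx 1)
                    (const_mx 1) (0 : 'M_1))).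

(* The algorithm outputs the wall with mirror point s. *)
Definition algorithm_outputs m heard s : Prop :=
  exists d : 'I_4 -> R,
    [/\ forall i, data m heard i (d i),
        f_D m d = 0
      & unique (fun x => forall i, sqdist x (m i) = d i) s].

Definition ghost walls m heard s : Prop :=
  algorithm_outputs m heard s /\ ~ (exists2 W, walls W & s = mirror W).

Definition good walls m heard : Prop :=
  (forall W, (forall i, heard i W) -> algorithm_outputs m heard (mirror W))
  /\ ~ (exists s, ghost walls m heard s).

End WallDetection.

(* S is the set of mirror points of the arrangement of walls. *)
Definition unlucky_stack (R : realType) (m : 'I_4 -> 'cV[R]_3)
    (S : set 'cV[R]_3) : Prop :=
  exists s : 'I_4 -> 'cV[R]_3,
    [/\ forall i, S (s i),
        exists p, forall i, exists t : R, s i = p + t *: e_z R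
      & forall i j, zcoord (s j - s i) = 2 * zcoord (m j - m i)].

(* A point of R^(3n) is read as the 3 x n matrix whose columns are the
   mirror points. *)
Definition arrangement_points (R : realType) (n : nat) (x : 'rV[R]_(3 * n)) :
    set 'cV[R]_3 :=
  range (fun j : 'I_n => col j (vec_mx x : 'M[R]_(3, n))).

Definition unlucky_arrangements (R : realType) (m : 'I_4 -> 'cV[R]_3)
    (n : nat) : set 'rV[R]_(3 * n) :=
  [set x | unlucky_stack m (arrangement_points x)].

(* Main.v *)
(** The dimension theory rests on one bound. For a chain [Z_0 < ... < Z_k] of
    irreducible closed sets pick [f_i] vanishing on [Z_i] but not on [Z_{i+1}];
    then [f_0, ..., f_{k-1}] are algebraically independent on [Z_k], and counting
    monomials bounds [k] by the number of parameters of any polynomial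
    parametrization of a set containing [Z_k].

    For (i), let a ghost wall with mirror point [x] come from the walls with
    mirror points [s_1, ..., s_4], which are then not all equal. Eliminating [x]
    from |x - m_i| = |s_i - m_i| gives one polynomial equation in the vehicle
    position. Suppose that it holds on all of G, and write s_i = C m_i^ini + c.
    Comparing the terms of degree two in the translation gives
    C C^T = A C^T + C A^T for every rotation A about the z-axis, so that C is 0 or
    twice the projection to the z-axis. The former contradicts the choice of the
    [s_i], and the latter is an unlucky stack. So the bad positions lie in finitely
    many proper closed subsets of the irreducible variety G.

    For (ii), an unlucky stack needs [l] distinct walls, one for each height, and
    one of their mirror points determines the [l - 1] others. *)
Require Import Defs.
From mathcomp Require Import all_boot all_order all_algebra.
From mathcomp Require Import mpoly.
From mathcomp Require Import boolp classical_sets functions cardinality reals.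
From mathcomp Require Import ring lra zify.

Import Order.TTheory GRing.Theory Num.Theory.

Local Open Scope classical_set_scope.
Local Open Scope ring_scope.

Set Implicit Arguments.
Unset Strict Implicit.
Unset Printing Implicit Defensive.

(** * Polynomial functions *)

Definition polyfun (R : realType) (N : nat) (f : 'rV[R]_N -> R) : Prop :=
  exists p : {mpoly R[N]}, forall x, f x = p.@[fun i => x 0 i].

Section PolynomialFunctions.
Variables (R : realType) (N : nat).
Implicit Types (f g : 'rV[R]_N -> R) (p : {mpoly R[N]}).

Lemma polyfun_eval p : polyfun (fun x : 'rV[R]_N => p.@[fun i => x 0 i]).
Proof. by exists p. Qed.

Lemma polyfun_cst (c : R) : polyfun (fun _ : 'rV[R]_N => c).
Proof. by exists c%:MP => x; rewrite mevalC. Qed.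

Lemma polyfun_coord (i : 'I_N) : polyfun (fun x : 'rV[R]_N => x 0 i).
Proof. by exists 'X_i => x; rewrite mevalXU. Qed.

Lemma polyfunD f g : polyfun f -> polyfun g -> polyfun (fun x => f x + g x).
Proof. by move=> [p fp] [q gq]; exists (p + q) => x; rewrite mevalD fp gq. Qed.

Lemma polyfunM f g : polyfun f -> polyfun g -> polyfun (fun x => f x * g x).
Proof. by move=> [p fp] [q gq]; exists (p * q) => x; rewrite mevalM fp gq. Qed.

Lemma polyfunB f g : polyfun f -> polyfun g -> polyfun (fun x => f x - g x).
Proof. by move=> [p fp] [q gq]; exists (p - q) => x; rewrite mevalB fp gq. Qed.

Lemma polyfunX f n : polyfun f -> polyfun (fun x => f x ^+ n).
Proof. by move=> [p fp]; exists (p ^+ n) => x; rewrite rmorphXn fp. Qed.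

Lemma polyfun_sum (I : Type) (r : seq I) (P : pred I) (F : I -> 'rV[R]_N -> R) :
  (forall i, polyfun (F i)) -> polyfun (fun x => \sum_(i <- r | P i) F i x).
Proof.
move=> /choice[p Fp]; exists (\sum_(i <- r | P i) p i) => x.
by rewrite raddf_sum; apply: eq_bigr => i _; rewrite Fp.
Qed.

Lemma polyfun_prod (I : Type) (r : seq I) (P : pred I) (F : I -> 'rV[R]_N -> R) :
  (forall i, polyfun (F i)) -> polyfun (fun x => \prod_(i <- r | P i) F i x).
Proof.
move=> /choice[p Fp]; exists (\prod_(i <- r | P i) p i) => x.
by rewrite rmorph_prod; apply: eq_bigr => i _; rewrite Fp.
Qed.

End PolynomialFunctions.

Definition polymap (R : realType) (m N : nat) (phi : 'rV[R]_m -> 'rV[R]_N) :=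
  forall i, polyfun (fun y => phi y 0 i).

Lemma polyfun_comp (R : realType) (m N : nat) (phi : 'rV[R]_m -> 'rV[R]_N)
    (f : 'rV[R]_N -> R) :
  polymap phi -> polyfun f -> polyfun (fun y => f (phi y)).
Proof.
move=> /choice[h phiE] [p fp]; exists (p \mPo [tuple h i | i < N]) => y.
rewrite fp comp_mpoly_meval; apply: meval_eq => i.
by rewrite tnth_mktuple phiE.
Qed.

(** * Zariski closed and irreducible sets *)

Section Zariski.
Variables (R : realType) (N : nat).
Implicit Types (f g : 'rV[R]_N -> R) (Z X Y A : set 'rV[R]_N).

Lemma zariski_closed_zeros (I : Type) (P : set I) (f : I -> 'rV[R]_N -> R) :
  (forall i, polyfun (f i)) ->
  zariski_closed [set x | forall i, P i -> f i x = 0].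
Proof.
move=> /choice[p fp]; exists (p @` P); apply/seteqP; split=> x /= fx.
  by move=> _ [i Pi <-]; rewrite -fp fx.
by move=> i Pi; rewrite fp fx//; exists i.
Qed.

Lemma zariski_closed_zero f : polyfun f -> zariski_closed [set x | f x = 0].
Proof.
move=> pf.
have := @zariski_closed_zeros unit setT (fun=> f) (fun=> pf).
congr zariski_closed; apply/seteqP; split=> x /= fx //.
exact: (fx tt).
Qed.

Lemma zariski_closedI A X : zariski_closed A -> zariski_closed X ->
  zariski_closed (A `&` X).
Proof.
move=> [I ->] [J ->]; exists (I `|` J); apply/seteqP; split=> x /=.
  by move=> [Ix Jx] p [/Ix|/Jx].
by move=> IJx; split=> p ?; apply: IJx; [left|right].
Qed.

(** Turns a proper inclusion of closed sets into a single polynomial function, the form in which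
    chains and covers are exploited below. *)
Lemma zariski_closed_sep Z x : zariski_closed Z -> ~ Z x ->
  exists f, [/\ polyfun f, forall z, Z z -> f z = 0 & f x <> 0].
Proof.
move=> [I ->] /= /existsNP[p /not_implyP[Ip px]].
exists (fun x => p.@[fun i => x 0 i]); split=> //; first exact: polyfun_eval.
by move=> z; apply.
Qed.

(** All products with one factor from the equations of each [A j] cut out the union: at a point
    outside it, a product of equations that fail there is nonzero. *)
Lemma zariski_closed_bigU (T : finType) (P : pred T) (A : T -> set 'rV[R]_N) :
  (forall j, zariski_closed (A j)) ->
  zariski_closed [set x | exists2 j, P j & A j x].
Proof.
move=> /choice[I AI].
exists [set p | exists2 q : T -> {mpoly R[N]},
  (forall j, P j -> I j (q j)) & p = \prod_(j | P j) q j].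
apply/seteqP; split=> x /=.
  move=> [j Pj]; rewrite AI /= => Ix _ [q Iq ->].
  by rewrite rmorph_prod (bigD1 j)//= Ix ?mul0r//; apply: Iq.
move=> H; apply: contrapT => nA.
have /choice[q Hq] : forall j, exists q, P j ->
    I j q /\ q.@[fun i => x 0 i] <> 0.
  move=> j; have [Pj|] := boolP (P j); last by exists 0.
  have nAj : ~ A j x by move=> Ax; apply: nA; exists j.
  by move: nAj; rewrite AI /= => /existsNP[q /not_implyP[? ?]]; exists q.
have : (\prod_(j | P j) q j).@[fun i => x 0 i] = 0.
  by apply: H; exists q => // j /Hq[].
rewrite rmorph_prod => /eqP/prodf_eq0[j Pj /eqP].
by have [_] := Hq j Pj.
Qed.

Lemma irreducible_mul Z f g : irreducible Z -> polyfun f -> polyfun g ->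
  (forall z, Z z -> f z * g z = 0) ->
  (forall z, Z z -> f z = 0) \/ (forall z, Z z -> g z = 0).
Proof.
move=> [_ irrZ] pf pg fg0.
apply: (irrZ _ _ (zariski_closed_zero pf) (zariski_closed_zero pg)) => z Zz.
by have /eqP := fg0 z Zz; rewrite mulf_eq0 => /orP[]/eqP; [left|right].
Qed.

(** Induction on the factors by [irreducible_mul]; the empty product 1 cannot vanish on Z because an
    irreducible set is nonempty. *)
Lemma irreducible_prod (T : eqType) (s : seq T) (P : pred T)
    (f : T -> 'rV[R]_N -> R) Z :
  irreducible Z -> (forall j, polyfun (f j)) ->
  (forall z, Z z -> \prod_(j <- s | P j) f j z = 0) ->
  exists j, [/\ j \in s, P j & forall z, Z z -> f j z = 0].
Proof.
move=> irrZ pf; elim: s => [|a s IHs] f0.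
  have [[z Zz] _] := irrZ.
  by have /eqP := f0 z Zz; rewrite big_nil oner_eq0.
have [Pa|nPa] := boolP (P a); last first.
  case: IHs => [z Zz|j [js Pj fj0]].
    by have := f0 z Zz; rewrite big_cons (negbTE nPa).
  by exists j; split=> //; rewrite in_cons js orbT.
have [fa0|fs0] : (forall z, Z z -> f a z = 0) \/
    (forall z, Z z -> \prod_(j <- s | P j) f j z = 0).
- apply: irreducible_mul irrZ (pf a) _ _; first exact: polyfun_prod.
  by move=> z /f0; rewrite big_cons Pa.
- by exists a; split=> //; rewrite in_cons eqxx.
- have [j [js Pj fj0]] := IHs fs0.
  by exists j; split=> //; rewrite in_cons js orbT.
Qed.

(** Otherwise choose, for each j with [P j], a function [f j] that is zero on [A j] but not on Z.
    Their product vanishes on Z, against [irreducible_prod]. *)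
Lemma irreducible_sub_bigU (T : finType) (P : pred T) (A : T -> set 'rV[R]_N) Z :
  irreducible Z -> (forall j, zariski_closed (A j)) ->
  Z `<=` [set x | exists2 j, P j & A j x] ->
  exists2 j, P j & Z `<=` A j.
Proof.
move=> irrZ clA ZA; apply: contrapT => nZ.
have /choice[f Hf] : forall j, exists f, polyfun f /\
    (P j -> (forall z, A j z -> f z = 0) /\ exists2 z, Z z & f z <> 0).
  move=> j; have [Pj|] := boolP (P j); last first.
    by exists (fun=> 0); split=> //; exact: polyfun_cst.
  have : ~ Z `<=` A j by move=> ZAj; apply: nZ; exists j.
  move=> /existsNP[z /not_implyP[Zz nAz]].
  have [f [pf fA fz]] := zariski_closed_sep (clA j) nAz.
  by exists f; split=> // _; split=> //; exists z.
have [||j [_ Pj fj0]] := @irreducible_prod T (index_enum T) P f Z irrZ.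
- by move=> j; have [] := Hf j.
- move=> z /ZA[j Pj Ajz]; rewrite (bigD1 j)//=.
  by have [_ /(_ Pj)[-> //]] := Hf j; rewrite mul0r.
- by have [_ /(_ Pj)[_ [z /fj0 ->]]] := Hf j.
Qed.

(* If [A] and [B] are closed, cover [X], and neither contains [X], pick [p] in
   [X] outside [A] and [q] in [X] outside [B]. *)
Lemma irreducible_connect X : X !=set0 ->
  (forall p q, X p -> X q ->
    exists Y, [/\ irreducible Y, Y `<=` X, Y p & Y q]) ->
  irreducible X.
Proof.
move=> X0 conn; split=> // A B clA clB XAB.
apply: contrapT => /not_orP[/existsNP[p /not_implyP[Xp nAp]]
  /existsNP[q /not_implyP[Xq nBq]]].
have [Y [[_ irrY] YX Yp Yq]] := conn p q Xp Xq.
by case: (irrY A B clA clB (subset_trans YX XAB)) => H; [apply: nAp|apply: nBq];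
  apply: H.
Qed.

End Zariski.

(** * Rational curves *)

(** The denominator has no real root, so a rational curve is defined on the whole line and the
    default value of division by zero never enters. *)
Definition ratfun (R : realType) (h : R -> R) : Prop :=
  exists F D : {poly R}, forall t, D.[t] != 0 /\ h t = F.[t] / D.[t].

Section RationalCurves.
Variable R : realType.
Implicit Types (g h : R -> R).

Lemma ratfun_cst (c : R) : ratfun (fun=> c).
Proof.
by exists c%:P, 1 => t; rewrite !hornerE oner_eq0 divr1; split.
Qed.

Lemma ratfun_id : ratfun (fun t : R => t).
Proof. by exists 'X, 1 => t; rewrite !hornerE oner_eq0 divr1; split. Qed.

Lemma ratfunD g h : ratfun g -> ratfun h -> ratfun (fun t => g t + h t).
Proof.
move=> [F [D gE]] [F' [D' hE]]; exists (F * D' + F' * D), (D * D') => t.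
have [D0 ->] := gE t; have [D'0 ->] := hE t.
by rewrite !hornerE mulf_neq0//; split=> //; field; rewrite D0 D'0.
Qed.

Lemma ratfunM g h : ratfun g -> ratfun h -> ratfun (fun t => g t * h t).
Proof.
move=> [F [D gE]] [F' [D' hE]]; exists (F * F'), (D * D') => t.
have [D0 ->] := gE t; have [D'0 ->] := hE t.
by rewrite !hornerM mulf_div mulf_neq0.
Qed.

Lemma ratfunN h : ratfun h -> ratfun (fun t => - h t).
Proof.
move=> [F [D hE]]; exists (- F), D => t; have [D0 ->] := hE t.
by rewrite hornerN mulNr.
Qed.

Lemma ratfunV h : (forall t, h t != 0) -> ratfun h -> ratfun (fun t => (h t)^-1).
Proof.
move=> h0 [F [D hE]]; exists D, F => t; have [D0 ht] := hE t.
have := h0 t; rewrite ht mulf_eq0 negb_or => /andP[F0 _]; split=> //.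
by rewrite invf_div.
Qed.

Lemma ratfunX h n : ratfun h -> ratfun (fun t => h t ^+ n).
Proof.
move=> rh; elim: n => [|n IHn]; first exact: ratfun_cst.
under eq_fun do rewrite exprS; exact: ratfunM.
Qed.

Lemma ratfun_sum (I : Type) (r : seq I) (F : I -> R -> R) :
  (forall i, ratfun (F i)) -> ratfun (fun t => \sum_(i <- r) F i t).
Proof.
move=> rF; elim: r => [|i r IHr].
  by under eq_fun do rewrite big_nil; exact: ratfun_cst.
by under eq_fun do rewrite big_cons; exact: ratfunD.
Qed.

Lemma ratfun_prod (I : Type) (r : seq I) (F : I -> R -> R) :
  (forall i, ratfun (F i)) -> ratfun (fun t => \prod_(i <- r) F i t).
Proof.
move=> rF; elim: r => [|i r IHr].
  by under eq_fun do rewrite big_nil; exact: ratfun_cst.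
by under eq_fun do rewrite big_cons; exact: ratfunM.
Qed.

Lemma polyfun_ratfun (N : nat) (f : 'rV[R]_N -> R) (gamma : R -> 'rV[R]_N) :
  (forall i, ratfun (fun t => gamma t 0 i)) -> polyfun f ->
  ratfun (fun t => f (gamma t)).
Proof.
move=> rg [p fp]; under eq_fun do rewrite fp mevalE.
apply: ratfun_sum => m; apply: ratfunM; first exact: ratfun_cst.
by apply: ratfun_prod => i; exact: ratfunX.
Qed.

Lemma poly_fun_eq0 (F : {poly R}) : (forall t, F.[t] = 0) -> F = 0.
Proof.
move=> F0; apply: (@roots_geq_poly_eq0 _ F [seq i%:R | i <- iota 0 (size F)]).
- by apply/allP => t _; rewrite /root F0.
- by rewrite map_inj_uniq ?iota_uniq// => i j /eqP; rewrite eqr_nat => /eqP.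
- by rewrite size_map size_iota.
Qed.

(** If neither A nor B contains the curve, take f and g vanishing on A and B but not on the curve.
    Pulled back to the line, their numerators have a product that vanishes everywhere, so one
    numerator is the zero polynomial. *)
Lemma irreducible_ratcurve (N : nat) (gamma : R -> 'rV[R]_N) :
  (forall i, ratfun (fun t => gamma t 0 i)) -> irreducible (range gamma).
Proof.
move=> rg; split; first by exists (gamma 0), 0.
move=> A B clA clB sub.
apply: contrapT => /not_orP[/existsNP[_ /not_implyP[[t _ <-] nA]]
  /existsNP[_ /not_implyP[[u _ <-] nB]]].
have [f [pf fA ft]] := zariski_closed_sep clA nA.
have [g [pg gB gu]] := zariski_closed_sep clB nB.
have [F [D fE]] := polyfun_ratfun rg pf.
have [F' [D' gE]] := polyfun_ratfun rg pg.
have : F * F' = 0.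
  apply: poly_fun_eq0 => s; rewrite hornerM; apply/eqP.
  have [D0 fs] := fE s; have [D'0 gs] := gE s.
  have [/fA fs0|/gB gs0] := sub (gamma s) (ex_intro2 _ _ s I erefl).
  - by move: fs; rewrite fs0 => /esym/eqP; rewrite !mulf_eq0 invr_eq0 (negbTE D0)
      orbF => ->.
  - by move: gs; rewrite gs0 => /esym/eqP; rewrite !mulf_eq0 invr_eq0 (negbTE D'0)
      orbF => ->; rewrite orbT.
move=> /eqP; rewrite mulf_eq0 => /orP[]/eqP F0.
- by apply: ft; have [_ ->] := fE t; rewrite F0 horner0 mul0r.
- by apply: gu; have [_ ->] := gE u; rewrite F0 horner0 mul0r.
Qed.

Lemma irreducible_ratconnect (N : nat) (X : set 'rV[R]_N) : X !=set0 ->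
  (forall p q, X p -> X q -> exists gamma : R -> 'rV[R]_N,
    [/\ forall i, ratfun (fun t => gamma t 0 i), forall t, X (gamma t),
        gamma 0 = p & gamma 1 = q]) ->
  irreducible X.
Proof.
move=> X0 conn; apply: irreducible_connect => // p q Xp Xq.
have [gamma [rg Xg g0 g1]] := conn p q Xp Xq.
exists (range gamma); split; first exact: irreducible_ratcurve.
- by move=> _ [t _ <-].
- by exists 0.
- by exists 1.
Qed.

(** Closed sets pull back to closed sets along [phi], so a closed cover of the image yields one of
    Y. *)
Lemma irreducible_range (m N : nat) (phi : 'rV[R]_m -> 'rV[R]_N)
    (Y : set 'rV[R]_m) :
  polymap phi -> irreducible Y -> irreducible (phi @` Y).
Proof.
move=> pphi [[y0 Y0] irrY]; split; first by exists (phi y0), y0.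
have pre A : zariski_closed A -> zariski_closed (phi @^-1` A).
  move=> [I ->].
  have := @zariski_closed_zeros R m {mpoly R[N]} I
    (fun p y => p.@[fun i => phi y 0 i]) _.
  by apply=> p; apply: polyfun_comp pphi (polyfun_eval p).
move=> A B /pre clA /pre clB sub.
have [|H|H] := irrY _ _ clA clB; first by move=> y Yy; apply: sub; exists y.
- by left=> _ [y /H ? <-].
- by right=> _ [y /H ? <-].
Qed.

End RationalCurves.

(** * Krull dimension *)

(** Exponent vectors of length k with entries below D, nested so that the exponent of the last
    variable comes first; [chain_mon_free] peels off that variable. *)
Fixpoint expo (D k : nat) : finType :=
  if k is k'.+1 then ('I_D * expo D k')%type else unit.

(** The ring is arbitrary because [mon] is applied both to polynomials and to their values at a
    point. *)
Fixpoint mon (A : comNzRingType) (D k : nat) (p : nat -> A) : expo D k -> A :=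
  match k return expo D k -> A with
  | 0 => fun _ => 1
  | k'.+1 => fun a => p k' ^+ a.1 * mon p a.2
  end.

Lemma card_expo (D k : nat) : #|expo D k| = (D ^ k)%N.
Proof.
elim: k => [|k IHk] /=; first by rewrite card_unit.
by rewrite card_prod card_ord IHk expnS.
Qed.

Lemma rmorph_mon (A B : comNzRingType) (f : {rmorphism A -> B}) (D k : nat)
    (p : nat -> A) (a : expo D k) : f (mon p a) = mon (fun i => f (p i)) a.
Proof.
elim: k a => [|k IHk] a /=; first by rewrite rmorph1.
by rewrite rmorphM rmorphXn IHk.
Qed.

(** * Algebraic dependence by counting monomials *)

Section MonomialCount.
Variables (R : realType) (m : nat).
Implicit Types (p q : {mpoly R[m]}).

(** [msize] is the degree plus one, and 0 for the zero polynomial; bounds of the form [s.+1] add up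
    like degrees. *)
Lemma msizeM_leS p q s t : (msize p <= s.+1)%N -> (msize q <= t.+1)%N ->
  (msize (p * q)%R <= (s + t).+1)%N.
Proof.
have [->|p0] := eqVneq p 0; first by rewrite mul0r msize0.
have [->|q0] := eqVneq q 0; first by rewrite mulr0 msize0.
move=> ps qt; rewrite msizeM//; move: (leq_add ps qt).
by rewrite addSn addnS; case: (_ + _)%N => // n /ltnW.
Qed.

Lemma msizeX_leS p s n : (msize p <= s.+1)%N -> (msize (p ^+ n)%R <= (n * s).+1)%N.
Proof.
move=> ps; elim: n => [|n IHn]; first by rewrite expr0 msize1.
by rewrite exprS mulSn; exact: msizeM_leS.
Qed.

Lemma msize_mon (D k s : nat) (q : nat -> {mpoly R[m]}) (a : expo D k) :
  (forall i, (i < k)%N -> (msize (q i) <= s.+1)%N) ->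
  (msize (mon q a) <= (k * (D * s)).+1)%N.
Proof.
elim: k a => [|k IHk] a qs /=; first by rewrite msize1.
rewrite mulSn; apply: msizeM_leS; last by apply: IHk => i ik; apply: qs; lia.
apply: leq_trans (msizeX_leS _ (qs k (ltnSn k))) _.
by rewrite ltnS leq_mul2r ltnW ?orbT.
Qed.

(* Compare the D^k monomials in [q] with exponents below D, all of degree O(D),
   with the O(D^m) monomials of that degree in the variables. *)
Lemma mon_dependent (k : nat) (q : nat -> {mpoly R[m]}) : (m < k)%N ->
  exists (D : nat) (c : expo D k -> R),
    \sum_a c a *: mon q a = 0 /\ exists a, c a != 0.
Proof.
move=> mk; pose s := (\max_(i < k) msize (q i))%N.
have qs i : (i < k)%N -> (msize (q i) <= s.+1)%N.
  by move=> ik; apply: leqW; exact: (leq_bigmax (Ordinal ik)).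
(* [E] exceeds k * D * s, which bounds the degree of each monomial in [q], and D > K ^ m gives E ^ m
   = K ^ m * D ^ m < D ^ m.+1 <= D ^ k: [A] has more rows than columns. *)
pose K := (k * s).+1; pose D := (K ^ m).+1; pose E := (K * D)%N.
pose A : 'M[R]_(#|expo D k|, #|{ffun 'I_m -> 'I_E}|) := \matrix_(i, j)
  (mon q (enum_val i))@_[multinom ((enum_val j : {ffun 'I_m -> 'I_E}) l : nat) | l < m].
have rankA : (\rank A < #|expo D k|)%N.
  apply: leq_ltn_trans (rank_leq_col A) _.
  rewrite card_ffun !card_ord card_expo expnMn.
  apply: (@leq_trans (D ^ m.+1)); last exact: leq_pexp2l.
  by rewrite expnS ltn_pmul2r ?expn_gt0.
have : kermx A != 0 by rewrite kermx_eq0 /row_free neq_ltn rankA.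
case/matrix0Pn => i [j ker_ij].
exists D, (fun a => kermx A i (enum_rank a)); split; last first.
  by exists (enum_val j); rewrite enum_valK.
apply/mpolyP => b; rewrite raddf_sum mcoeff0 /=.
(* Exponents with an entry at least [E] occur in no [mon q a] for degree reasons; all others index
   columns of [A]. *)
have [b_small|b_big] := boolP [forall l, b l < E]%N; last first.
  apply: big1 => a _; rewrite mcoeffZ memN_msupp_eq0 ?mulr0//.
  apply: msize_mdeg_ge; have [l lE] := forallPn b_big.
  apply: leq_trans (msize_mon a qs) _.
  have : (b l <= mdeg b)%N by rewrite mdegE (bigD1 l)//= leq_addr.
  apply: leq_trans; move: lE; rewrite -leqNgt; apply: leq_trans.
  rewrite /E /K mulSn mulnCA mulnA [(D * _)%N]mulnC; rewrite /D; lia.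
pose bE : {ffun 'I_m -> 'I_E} :=
  [ffun l => Ordinal (forallP b_small l)].
have bEE : [multinom (bE l : nat) | l < m] = b.
  by apply/mnmP => l; rewrite mnmE ffunE.
have := congr1 (fun M : 'M_(_, _) => M i (enum_rank bE)) (mulmx_ker A).
rewrite !mxE => ker0; rewrite -[RHS]ker0 (reindex (@enum_val _ predT))/=; last first.
  by apply: onW_bij; exact: enum_val_bij.
apply: eq_bigr => a _.
by rewrite mcoeffZ enum_valK [A _ _]mxE enum_rankK bEE.
Qed.

End MonomialCount.

(** * Chains of irreducible closed sets *)

Section Dimension.
Variable R : realType.

Lemma polyfun_mon (N : nat) (D k : nat) (f : nat -> 'rV[R]_N -> R)
    (a : expo D k) :
  (forall i, polyfun (f i)) -> polyfun (fun x => mon (fun i => f i x) a).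
Proof.
move=> pf; elim: k a => [|k IHk] a /=; first exact: polyfun_cst.
by apply: polyfunM => //; exact: polyfunX.
Qed.

(* If a polynomial relation between [f 0, ..., f j] holds on [Z j.+1], dividing
   it by a power of [f j] and restricting to [Z j], where [f j] vanishes, yields
   a relation between [f 0, ..., f j.-1]. *)
Lemma chain_mon_free (N k : nat) (Z : nat -> set 'rV[R]_N)
    (f : nat -> 'rV[R]_N -> R) :
  (forall i, (i <= k)%N -> irreducible (Z i)) ->
  (forall i, (i < k)%N -> Z i `<=` Z i.+1) ->
  (forall i, polyfun (f i)) ->
  (forall i, (i < k)%N -> forall z, Z i z -> f i z = 0) ->
  (forall i, (i < k)%N -> ~ forall z, Z i.+1 z -> f i z = 0) ->
  forall D j (c : expo D j -> R), (j <= k)%N ->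
    (forall z, Z j z -> \sum_a c a * mon (fun i => f i z) a = 0) ->
    forall a, c a = 0.
Proof.
move=> irrZ subZ pf f0 fN0 D; elim=> [|j IHj] c jk c0 a.
  have [[z Zz] _] := irrZ 0%N jk; have := c0 z Zz.
  by case: a; rewrite (big_pred1 tt) ?mulr1//; case.
apply: contrapT => /eqP ca.
pose P e := [exists a', c (e, a') != 0].
have Pa : P a.1 by apply/existsP; exists a.2; case: (a) ca.
(* [e] is the least exponent of [f j] in the relation. Dividing by [f j ^+ e] leaves [h], in which
   [g e] is the only term without a factor [f j]. *)
case: (arg_minnP val Pa) => e /existsP[a' ca'] emin.
pose g (e : 'I_D) z := \sum_a' c (e, a') * mon (fun i => f i z) a'.
pose h z := \sum_(e' < D | (e <= e')%N) f j z ^+ (e' - e) * g e' z.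
have pfX n : polyfun (fun z => f j z ^+ n) by exact: polyfunX.
have ph : polyfun h.
  apply: polyfun_sum => e'; apply: polyfunM => //.
  apply: polyfun_sum => b; apply: polyfunM; first exact: polyfun_cst.
  exact: polyfun_mon.
have fh0 z : Z j.+1 z -> f j z ^+ e * h z = 0.
  move=> /c0 <-; rewrite /h mulr_sumr big_mkcond.
  pose G e' a' := c (e', a') * (f j z ^+ (e' : 'I_D) * mon (fun i => f i z) a').
  transitivity (\sum_e' \sum_a' G e' a'); last first.
    by rewrite pair_bigA; apply: eq_bigr => -[].
  apply: eq_bigr => e' _; rewrite /G.
  case: leqP => [ee'|e'e].
    rewrite mulrA -exprD subnKC// mulr_sumr; apply: eq_bigr => b _.
    by rewrite mulrCA.
  rewrite big1// => b _; have [->|cb] := eqVneq (c (e', b)) 0; first by rewrite mul0r.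
  suff : P e' by move=> /emin; rewrite leqNgt e'e.
  by apply/existsP; exists b.
have [H|H] := irreducible_mul (irrZ _ jk) (pfX e) ph fh0.
  apply: (fN0 _ jk) => z /H /eqP; rewrite expf_eq0 => /andP[_ /eqP] //.
suff : c (e, a') = 0 by apply/eqP.
apply: (IHj (fun a' => c (e, a')) (ltnW jk)) => z Zz.
have := H z (subZ _ jk _ Zz); rewrite /h (bigD1 e)//= subnn mul1r big1 ?addr0//.
move=> e' /andP[ee' e'e]; rewrite (f0 _ jk _ Zz) expr0n.
by rewrite subn_eq0 leqNgt ltn_neqAle ee' eq_sym e'e mul0r.
Qed.

(** If k > m, the k functions separating consecutive members of the chain become dependent
    polynomials in m variables when composed with [phi]. The dependence holds on [Z k], against
    [chain_mon_free]. *)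
Lemma chain_range_bound (m N k : nat) (phi : 'rV[R]_m -> 'rV[R]_N)
    (X : set 'rV[R]_N) :
  polymap phi -> X `<=` range phi -> has_chain X k -> (k <= m)%N.
Proof.
move=> pphi Xphi [Z [Zirr Zlt]]; rewrite leqNgt; apply/negP => mk.
have /choice[f Hf] : forall i, exists f : 'rV[R]_N -> R, polyfun f /\
    ((i < k)%N -> (forall z, Z i z -> f z = 0) /\
      ~ forall z, Z i.+1 z -> f z = 0).
  move=> i; case: (ltnP i k) => ik; last first.
    by exists (fun=> 0); split=> //; exact: polyfun_cst.
  have [_ /existsNP[z /not_implyP[Zz nZz]]] := Zlt i ik.
  have [clZ _ _] := Zirr i (ltnW ik).
  have [f [pf fZ fz]] := zariski_closed_sep clZ nZz.
  by exists f; split=> // _; split=> // /(_ z Zz).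
have pf i : polyfun (f i) by have [] := Hf i.
have /choice[q qE] := fun i => polyfun_comp pphi (pf i).
have [D [c [c0 [a /eqP ca]]]] := mon_dependent q mk.
apply: ca; apply: (@chain_mon_free N k Z f _ _ _ _ _ D k c _ _ a) => //.
- by move=> i /Zirr[].
- by move=> i /Zlt[].
- by move=> i ik; have [_ /(_ ik)[]] := Hf i.
- by move=> i ik; have [_ /(_ ik)[]] := Hf i.
- have [_ _ ZX] := Zirr k (leqnn k).
  move=> z /ZX/Xphi[y _ <-].
  have := congr1 (meval (fun i => y 0 i)) c0.
  rewrite meval0 raddf_sum => c0y; rewrite -[RHS]c0y; apply: eq_bigr => b _.
  rewrite /= mevalZ; congr (_ * _).
  rewrite rmorph_mon; congr (mon _ b); apply/funext => i /=; exact: qE.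
Qed.

Lemma has_chain_sub (N k : nat) (X Y : set 'rV[R]_N) : X `<=` Y ->
  has_chain X k -> has_chain Y k.
Proof.
move=> XY [Z [Zirr Zlt]]; exists Z; split=> // i /Zirr[clZ irrZ ZX].
by split=> //; exact: subset_trans XY.
Qed.

(** Serves in both directions: it raises lower bounds from X to Y, and it lowers upper bounds from Y
    to X. *)
Lemma has_chainS (N k : nat) (X Y : set 'rV[R]_N) :
  zariski_closed Y -> irreducible Y -> X `<` Y ->
  has_chain X k -> has_chain Y k.+1.
Proof.
move=> clY irrY [XY nYX] [Z [Zirr Zlt]].
exists (fun i => if (i <= k)%N then Z i else Y); split=> i.
  case: (leqP i k) => [/Zirr[clZ irrZ ZX]|_ _]; last by split.
  by split=> //; exact: subset_trans XY.
rewrite ltnS => ik; rewrite ik; case: (ltnP i k) => [/Zlt//|ki].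
have /Zirr[_ _ ZX] := ik; split; first exact: subset_trans XY.
by move=> YZ; apply: nYX; exact: subset_trans ZX.
Qed.

(** Since t ranges over all of R, these are the affine subspaces, and whole lines serve as
    connecting curves. *)
Lemma irreducible_convex (N : nat) (X : set 'rV[R]_N) : X !=set0 ->
  (forall p q t, X p -> X q -> X (p + t *: (q - p))) -> irreducible X.
Proof.
move=> X0 line; apply: irreducible_ratconnect => // p q Xp Xq.
exists (fun t => p + t *: (q - p)); split.
- move=> i; under eq_fun do rewrite !mxE.
  apply: ratfunD; first exact: ratfun_cst.
  by apply: ratfunM; [exact: ratfun_id|exact: ratfun_cst].
- by move=> t; exact: line.
- by rewrite scale0r addr0.
- by rewrite scale1r addrC subrK.
Qed.

(** The left inverse makes the images of coordinate subspaces closed, which gives a chain of length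
    m; [chain_range_bound] excludes longer ones. *)
Lemma has_dim_retract (m N : nat) (phi : 'rV[R]_m -> 'rV[R]_N)
    (psi : 'rV[R]_N -> 'rV[R]_m) :
  polymap phi -> polymap psi -> cancel phi psi ->
  [/\ zariski_closed (range phi), irreducible (range phi)
    & has_dim (range phi) m].
Proof.
move=> pphi ppsi phiK.
have irrS (S : pred 'I_m) :
    irreducible (phi @` [set y : 'rV[R]_m | forall i, S i -> y 0 i = 0]).
  apply: irreducible_range => //; apply: irreducible_convex.
    by exists 0 => i _; rewrite mxE.
  move=> p q t p0 q0 i Si; rewrite !mxE p0 ?q0//; ring.
have clS (S : pred 'I_m) :
    zariski_closed (phi @` [set y : 'rV[R]_m | forall i, S i -> y 0 i = 0]).
  (* A point x is in the image of [phi] exactly when phi (psi x) = x, which is a system of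
     polynomial equations. *)
  have -> : phi @` [set y : 'rV[R]_m | forall i, S i -> y 0 i = 0] =
      [set x | forall i, setT i -> phi (psi x) 0 i - x 0 i = 0] `&`
      [set x | forall i, S i -> psi x 0 i = 0].
    apply/seteqP; split=> x.
      by move=> [y /= y0 <-]; split=> i /=; rewrite phiK ?subrr// => /y0.
    move=> [/= phix psix]; exists (psi x) => //.
    by apply/rowP => i; apply/eqP; rewrite -subr_eq0 phix.
  apply: zariski_closedI; apply: zariski_closed_zeros => // i.
  apply: polyfunB; last exact: polyfun_coord.
  exact: (polyfun_comp ppsi (pphi i)).
have rangeE : range phi = phi @` [set y : 'rV[R]_m | forall i, pred0 i -> y 0 i = 0].
  by congr (_ @` _); apply/seteqP; split=> y.
split; [by rewrite rangeE|by rewrite rangeE|split; last first].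
  by move=> k; exact: chain_range_bound.
exists (fun j => phi @` [set y : 'rV[R]_m | forall i : 'I_m, (j <= i)%N -> y 0 i = 0]).
split=> j jm.
  split; [exact: clS|exact: irrS|by move=> _ [y _ <-]; exists y].
split; first by move=> _ [y y0 <-]; exists y => // i ji; apply: y0; exact: ltnW.
(* The basis vector with index j, counted from 0, lies in step j + 1 of the flag but not in step
   j. *)
pose e : 'rV[R]_m := delta_mx 0 (Ordinal jm).
move=> /(_ (phi e)) []; first exists e => // i ji.
  by rewrite mxE eqxx/= -val_eqE/= gtn_eqF.
move=> y y0 /(congr1 psi); rewrite !phiK => ye.
have /eqP := y0 (Ordinal jm) (leqnn _).
by rewrite ye mxE !eqxx oner_eq0.
Qed.

Lemma has_dimT (N : nat) : has_dim [set: 'rV[R]_N] N.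
Proof.
have pid : polymap (@id 'rV[R]_N) by move=> i; exact: polyfun_coord.
have [_ _] := @has_dim_retract N N id id pid pid (fun=> erefl).
by congr has_dim; apply/seteqP; split=> // x _; exists x.
Qed.

(** The top of a chain is irreducible, hence lies in a single [A j], and the rest of the chain lies
    below it. *)
Lemma has_dim_bigU (N d : nat) (T : finType) (P : pred T)
    (A : T -> set 'rV[R]_N) :
  (forall j, zariski_closed (A j)) -> (forall j, P j -> has_dim (A j) d) ->
  (exists j, P j) -> has_dim [set x | exists2 j, P j & A j x] d.
Proof.
move=> clA dimA [j0 Pj0]; split.
  have [ch _] := dimA j0 Pj0; apply: has_chain_sub ch => x Ax.
  by exists j0.
move=> k [Z [Zirr Zlt]]; have [clZ irrZ ZU] := Zirr k (leqnn k).
have [j Pj ZA] := irreducible_sub_bigU irrZ clA ZU.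
have [_] := dimA j Pj; apply; exists Z; split=> // i ik.
have [clZi irrZi _] := Zirr i ik; split=> //; apply: subset_trans ZA.
elim: k {clZ irrZ ZU Zirr} Zlt ik => [|k IHk] Zlt; first by rewrite leqn0 => /eqP->.
rewrite leq_eqVlt => /orP[/eqP->//|ik].
have [Zk _] := Zlt k (ltnSn k); apply: subset_trans Zk.
by apply: IHk => // l lk; apply: Zlt; exact: ltnW.
Qed.

Lemma dim_lt_proper (N d : nat) (X V : set 'rV[R]_N) :
  zariski_closed X -> irreducible X -> has_dim X d -> V `<` X -> dim_lt V d.
Proof. by move=> clX irrX [_ dimX] VX k /(has_chainS clX irrX VX)/dimX. Qed.

End Dimension.

(** * The variety of vehicle positions *)

Section VehicleVariety.
Variable R : realType.
Implicit Types (c s : R) (x : 'cV[R]_3) (a : 'rV[R]_(2 * 2 + 3)).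

Definition rot2 c s : 'M[R]_2 :=
  \matrix_(i, j) (if i == j then c else if i == 0 then - s else s).

(** The relation c ^+ 2 + s ^+ 2 = 1 is not imposed: the values form a linear space of dimension 5
    around the group. *)
Definition vpos c s x : 'rV[R]_(2 * 2 + 3) := row_mx (mxvec (rot2 c s)) x^T.

Lemma rotation_part_vpos c s x : rotation_part (vpos c s x) = rot2 c s.
Proof. by rewrite /rotation_part row_mxKl mxvecK. Qed.

Lemma translation_part_vpos c s x : translation_part (vpos c s x) = x.
Proof. by rewrite /translation_part row_mxKr trmxK. Qed.

Lemma vehicle_eq a b : rotation_part a = rotation_part b ->
  translation_part a = translation_part b -> a = b.
Proof.
rewrite /rotation_part /translation_part => /(can_inj vec_mxK) ab /trmx_inj ab'.
by rewrite -[a]hsubmxK -[b]hsubmxK ab ab'.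
Qed.

Lemma vehicle_coordP (i : 'I_(2 * 2 + 3)) :
  (exists j k, forall a, a 0 i = rotation_part a j k) \/
  (exists k, forall a, a 0 i = translation_part a k 0).
Proof.
case: (split_ordP i) => [l ->|k ->].
  left; case/mxvec_indexP: l => j k; exists j, k => a.
  by rewrite /rotation_part !mxE.
by right; exists k => a; rewrite /translation_part !mxE.
Qed.

Lemma polyfun_rotation j k : polyfun (fun a => rotation_part a j k).
Proof.
rewrite /rotation_part; under eq_fun do rewrite !mxE.
exact: polyfun_coord.
Qed.

Lemma polyfun_translation k : polyfun (fun a => translation_part a k 0).
Proof.
rewrite /translation_part; under eq_fun do rewrite !mxE.
exact: polyfun_coord.
Qed.

Lemma polymap_vpos (m : nat) (c s : 'rV[R]_m -> R) (x : 'rV[R]_m -> 'cV[R]_3) :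
  polyfun c -> polyfun s -> (forall k, polyfun (fun y => x y k 0)) ->
  polymap (fun y => vpos (c y) (s y) (x y)).
Proof.
move=> pc ps px i; have [[j [k E]]|[k E]] := vehicle_coordP i.
  under eq_fun do rewrite E rotation_part_vpos mxE.
  case: (j == k) => //; case: (j == 0) => //.
  under eq_fun do rewrite -[- _]add0r.
  by apply: polyfunB => //; exact: polyfun_cst.
by under eq_fun do rewrite E translation_part_vpos.
Qed.

Lemma ratfun_vpos (c s : R -> R) (x : R -> 'cV[R]_3) i :
  ratfun c -> ratfun s -> (forall k, ratfun (fun t => x t k 0)) ->
  ratfun (fun t => vpos (c t) (s t) (x t) 0 i).
Proof.
move=> rc rs rx; have [[j [k E]]|[k E]] := vehicle_coordP i.
  under eq_fun do rewrite E rotation_part_vpos mxE.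
  by case: (j == k) => //; case: (j == 0) => //; exact: ratfunN.
by under eq_fun do rewrite E translation_part_vpos.
Qed.

Lemma ord2P (i : 'I_2) : i = 0 \/ i = 1.
Proof. by case: i => -[|[|//]] ?; [left|right]; apply: val_inj. Qed.

Lemma det_mx2 (M : 'M[R]_2) : \det M = M 0 0 * M 1 1 - M 0 1 * M 1 0.
Proof.
rewrite (expand_det_row _ 0) !big_ord_recl big_ord0 /cofactor !det_mx11 !mxE /=.
have l0 : lift 0 0 = 1 :> 'I_2 by apply: val_inj.
have l1 : lift 1 0 = 0 :> 'I_2 by apply: val_inj.
by rewrite !l0 l1 /= addn0 expr0 expr1; ring.
Qed.

Lemma vehicle_positions_vpos c s x : c ^+ 2 + s ^+ 2 = 1 ->
  vehicle_positions (vpos c s x).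
Proof.
move=> cs1; rewrite /vehicle_positions /= rotation_part_vpos; split.
  apply/matrixP => i j; rewrite !mxE !big_ord_recl big_ord0 !mxE.
  by case: (ord2P i) => ->; case: (ord2P j) => -> /=; rewrite -?cs1; ring.
by rewrite det_mx2 !mxE /= -cs1; ring.
Qed.

Lemma vehicle_positionsP a : vehicle_positions a ->
  exists c s x, c ^+ 2 + s ^+ 2 = 1 /\ a = vpos c s x.
Proof.
move=> [/matrixP orth]; rewrite det_mx2.
have l0 : lift 0 0 = 1 :> 'I_2 by apply: val_inj.
have sumE i j : rotation_part a i 0 * rotation_part a j 0 +
    rotation_part a i 1 * rotation_part a j 1 = (i == j)%:R.
  have -> : (i == j)%:R = (1%:M : 'M[R]_2) i j by rewrite mxE.
  by rewrite -orth [RHS]mxE !big_ord_recl big_ord0 addr0 l0 ![_^T _ _]mxE.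
have := sumE 0 0; have := sumE 1 1.
set p := rotation_part a 0 0; set q := rotation_part a 0 1.
set r := rotation_part a 1 0; set t := rotation_part a 1 1 => rt pq det1.
have [pt qr] : p = t /\ q = - r.
  (* For a matrix with orthonormal rows and determinant 1 this sum of squares is 1 + 1 - 2 = 0. *)
  have : (p - t) ^+ 2 + (q + r) ^+ 2 =
    (p * p + q * q) + (r * r + t * t) - 2 * (p * t - q * r) by ring.
  rewrite rt pq det1 !eqxx mulr1 -mulr2n subrr => /eqP; rewrite paddr_eq0 ?sqr_ge0// !sqrf_eq0 subr_eq0 addr_eq0.
  by move=> /andP[/eqP-> /eqP->].
exists p, r, (translation_part a); split.
  by move: pq; rewrite eqxx qr mulrNN -!expr2.
apply: vehicle_eq; last by rewrite translation_part_vpos.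
rewrite rotation_part_vpos; apply/matrixP => i j; rewrite [RHS]mxE.
by case: (ord2P i) => ->; case: (ord2P j) => -> //=; rewrite -/t -/q ?pt ?qr.
Qed.

Lemma zariski_closed_vehicle_positions : zariski_closed (@vehicle_positions R).
Proof.
have -> : @vehicle_positions R =
  [set a | forall ij, setT ij ->
     (rotation_part a *m (rotation_part a)^T) ij.1 ij.2 - (1%:M : 'M_2) ij.1 ij.2 = 0]
  `&` [set a | \det (rotation_part a) - 1 = 0].
  apply/seteqP; split=> a /= [orth det1]; split=> //.
  - by move=> ij _; rewrite orth subrr.
  - by rewrite det1 subrr.
  - by apply/matrixP => i j; apply/eqP; rewrite -subr_eq0 (orth (i, j)).
  - by apply/eqP; rewrite -subr_eq0 det1.
apply: zariski_closedI; [apply: zariski_closed_zeros => -[i j] /=|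
  apply: zariski_closed_zero].
  apply: polyfunB; last exact: polyfun_cst.
  under eq_fun do rewrite !mxE.
  apply: polyfun_sum => k; apply: polyfunM; first exact: polyfun_rotation.
  by under eq_fun do rewrite mxE; exact: polyfun_rotation.
apply: polyfunB; last exact: polyfun_cst.
apply: polyfun_sum => sigma; apply: polyfunM; first exact: polyfun_cst.
by apply: polyfun_prod => k; exact: polyfun_rotation.
Qed.

(** The vector (1 + c, s) points along the half angle; it vanishes for the half turn, where (0, 1)
    is taken. The homogeneous form avoids square roots. *)
Lemma half_angle c s : c ^+ 2 + s ^+ 2 = 1 -> exists u v,
  [/\ u ^+ 2 + v ^+ 2 != 0, u ^+ 2 - v ^+ 2 = c * (u ^+ 2 + v ^+ 2)
    & 2 * u * v = s * (u ^+ 2 + v ^+ 2)].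
Proof.
move=> cs; have [cN1|cN1] := eqVneq c (-1).
  exists 0, 1; split; rewrite ?cN1 ?expr0n ?expr1n ?add0r ?oner_eq0//; first by ring.
  suff -> : s = 0 by ring.
  by apply/eqP; rewrite -sqrf_eq0; apply/eqP; move: cs; rewrite cN1; lra.
exists (1 + c), s.
have -> : (1 + c) ^+ 2 + s ^+ 2 = 2 * (1 + c) by move: cs; lra.
split; last by ring.
  by rewrite mulf_neq0 ?pnatr_eq0// addrC addr_eq0.
have -> : s ^+ 2 = 1 - c ^+ 2 by move: cs; lra.
by ring.
Qed.

(* Rotations are parametrized by the half angle: the rational curve comes from
   the segment between half-angle representatives, which avoids the origin
   unless the two representatives are parallel. *)
Lemma irreducible_vehicle_positions : irreducible (@vehicle_positions R).
Proof.
apply: irreducible_ratconnect.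
  exists (vpos 1 0 0); apply: vehicle_positions_vpos; ring.
move=> p q /vehicle_positionsP[c [s [x [cs ->]]]].
move=> /vehicle_positionsP[c' [s' [x' [cs' ->]]]].
have [u [v [uv0 cE sE]]] := half_angle cs.
(* Parallel representatives belong to the same rotation; in that case (u, v) is used at both ends
   and the segment is constant. *)
have [u' [v' [uv'0 c'E s'E nz]]] : exists u' v',
  [/\ u' ^+ 2 + v' ^+ 2 != 0, u' ^+ 2 - v' ^+ 2 = c' * (u' ^+ 2 + v' ^+ 2),
    2 * u' * v' = s' * (u' ^+ 2 + v' ^+ 2)
    & (u' = u /\ v' = v) \/ u * v' - v * u' != 0].
  have [u' [v' [uv'0 c'E s'E]]] := half_angle cs'.
  have [par|] := eqVneq (u * v' - v * u') 0; last first.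
    by exists u', v'; split=> //; right.
  have uv : (u ^+ 2 + v ^+ 2) * (u' ^+ 2 + v' ^+ 2) != 0 by rewrite mulf_neq0.
  have cc' : c = c'.
    apply: (mulIf uv); rewrite mulrA -cE mulrCA -c'E.
    have -> : (u ^+ 2 - v ^+ 2) * (u' ^+ 2 + v' ^+ 2) =
       (u ^+ 2 + v ^+ 2) * (u' ^+ 2 - v' ^+ 2) +
       2 * (u * v' - v * u') * (u * v' + v * u') by ring.
    by rewrite par mulr0 mul0r addr0.
  have ss' : s = s'.
    apply: (mulIf uv); rewrite mulrA -sE mulrCA -s'E.
    have -> : 2 * u * v * (u' ^+ 2 + v' ^+ 2) =
      (u ^+ 2 + v ^+ 2) * (2 * u' * v') +
      2 * (u * v' - v * u') * (v * v' - u * u') by ring.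
    by rewrite par mulr0 mul0r addr0.
  by exists u, v; rewrite -cc' -ss'; split=> //; left.
pose U t := u + t * (u' - u); pose V t := v + t * (v' - v).
have UV0 t : U t ^+ 2 + V t ^+ 2 != 0.
  rewrite paddr_eq0 ?sqr_ge0// !sqrf_eq0; apply/negP => /andP[/eqP U0 /eqP V0].
  move: U0 V0; rewrite /U /V; case: nz => [[-> ->]|nz U0 V0].
    by rewrite !subrr !mulr0 !addr0 => u0 v0; move: uv0; rewrite u0 v0 expr0n addr0 eqxx.
  have t1 : (1 - t) * (u * v' - v * u') = 0.
    transitivity ((u + t * (u' - u)) * v' - (v + t * (v' - v)) * u'); first by ring.
    by rewrite U0 V0 !mul0r subrr.
  have t0 : t * (u * v' - v * u') = 0.
    transitivity ((v + t * (v' - v)) * u - (u + t * (u' - u)) * v); first by ring.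
    by rewrite U0 V0 !mul0r subrr.
  by case/negP: nz; apply/eqP; rewrite -[LHS]mul1r -[1](subrK t) mulrDl t1 t0 addr0.
have rU : ratfun U.
  apply: ratfunD; first exact: ratfun_cst.
  by apply: ratfunM; [exact: ratfun_id|exact: ratfun_cst].
have rV : ratfun V.
  apply: ratfunD; first exact: ratfun_cst.
  by apply: ratfunM; [exact: ratfun_id|exact: ratfun_cst].
have rUV : ratfun (fun t => (U t ^+ 2 + V t ^+ 2)^-1).
  by apply: ratfunV => //; apply: ratfunD; exact: ratfunX.
exists (fun t => vpos ((U t ^+ 2 - V t ^+ 2) / (U t ^+ 2 + V t ^+ 2))
   (2 * U t * V t / (U t ^+ 2 + V t ^+ 2)) (x + t *: (x' - x))); split.
- move=> i; apply: ratfun_vpos.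
  + apply: ratfunM => //; apply: ratfunD; first exact: ratfunX.
    by apply: ratfunN; exact: ratfunX.
  + apply: ratfunM => //; apply: ratfunM => //; apply: ratfunM => //.
    exact: ratfun_cst.
  + move=> k; under eq_fun do rewrite !mxE.
    apply: ratfunD; first exact: ratfun_cst.
    by apply: ratfunM; [exact: ratfun_id|exact: ratfun_cst].
- by move=> t; apply: vehicle_positions_vpos; field; exact: UV0.
- rewrite /U /V !mul0r !addr0 scale0r addr0 cE sE.
  by congr vpos; rewrite mulfK.
- rewrite /U /V !mul1r scale1r !(addrC _ (u' - _)) !(addrC _ (v' - _)).
  rewrite (addrC x) !subrK c'E s'E.
  by congr vpos; rewrite mulfK.
Qed.

(** The group lies strictly between the 3-dimensional set of pure translations and a 5-dimensional
    linear space. *)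
Lemma has_dim_vehicle_positions : has_dim (@vehicle_positions R) 4.
Proof.
split.
  pose phi (y : 'rV[R]_3) := vpos 1 0 y^T.
  pose psi a := (translation_part a)^T.
  have [||y|_ _ [ch _]] := @has_dim_retract R 3 _ phi psi.
  - apply: polymap_vpos; [exact: polyfun_cst|exact: polyfun_cst|move=> k].
    by under eq_fun do rewrite mxE; exact: polyfun_coord.
  - move=> i; under eq_fun do rewrite mxE; exact: polyfun_translation.
  - by rewrite /psi translation_part_vpos trmxK.
  apply: has_chainS ch; [exact: zariski_closed_vehicle_positions|
    exact: irreducible_vehicle_positions|split].
    by move=> _ [y _ <-]; apply: vehicle_positions_vpos; ring.
  (* The quarter turn is not a translation. *)
  move=> /(_ (vpos 0 1 0)) []; first by apply: vehicle_positions_vpos; ring.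
  move=> y _ /(congr1 (fun a => rotation_part a 0 0)).
  by rewrite !rotation_part_vpos !mxE => /eqP; rewrite oner_eq0.
move=> k Gk; rewrite -ltnS.
pose phi (y : 'rV[R]_(2 + 3)) := vpos (lsubmx y 0 0) (lsubmx y 0 1) (rsubmx y)^T.
pose psi a : 'rV[R]_(2 + 3) :=
  row_mx (row 0 (rotation_part a)^T) (translation_part a)^T.
have [||y|cl5 irr5 [_ dim5]] := @has_dim_retract R (2 + 3) _ phi psi.
- by apply: polymap_vpos => *; under eq_fun do rewrite !mxE; exact: polyfun_coord.
- move=> i; case: (split_ordP i) => j ->.
    under eq_fun do rewrite row_mxEl mxE mxE; exact: polyfun_rotation.
  under eq_fun do rewrite row_mxEr mxE; exact: polyfun_translation.
- rewrite /psi rotation_part_vpos translation_part_vpos trmxK -[RHS]hsubmxK.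
  congr row_mx; apply/rowP => j; rewrite !mxE.
  by case: (ord2P j) => ->.
apply/dim5/(has_chainS cl5 irr5 _ Gk); split.
  move=> _ /vehicle_positionsP[c [s [x [_ ->]]]].
  exists (row_mx (\row_j (if j == 0 then c else s)) x^T) => //.
  by rewrite /phi row_mxKl row_mxKr trmxK !mxE.
move=> /(_ (vpos 0 0 0)) []; first by exists 0; rewrite // /phi !raddf0 !mxE.
move=> _; rewrite rotation_part_vpos det_mx2 !mxE /= !mulr0 subr0 => /eqP.
by rewrite eq_sym oner_eq0.
Qed.

End VehicleVariety.

(** * Ghost walls *)

Section Dot.
Variable R : realType.
Implicit Types (u v w x : 'cV[R]_3) (M : 'M[R]_3).

Lemma dotvE u v : dotv u v = (u^T *m v) 0 0.
Proof. by rewrite mxE; apply: eq_bigr => i _; rewrite mxE. Qed.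

Lemma dotvC u v : dotv u v = dotv v u.
Proof. by apply: eq_bigr => i _; rewrite mulrC. Qed.

Lemma dotvDl u v w : dotv (u + v) w = dotv u w + dotv v w.
Proof. by rewrite !dotvE linearD mulmxDl mxE. Qed.

Lemma dotvZl (k : R) u w : dotv (k *: u) w = k * dotv u w.
Proof. by rewrite !dotvE linearZ -scalemxAl mxE. Qed.

Lemma dotvNl u w : dotv (- u) w = - dotv u w.
Proof. by rewrite -scaleN1r dotvZl mulN1r. Qed.

Lemma dotvDr u v w : dotv w (u + v) = dotv w u + dotv w v.
Proof. by rewrite !(dotvC w) dotvDl. Qed.

Lemma dotvZr (k : R) u w : dotv w (k *: u) = k * dotv w u.
Proof. by rewrite !(dotvC w) dotvZl. Qed.

Lemma dotvNr u w : dotv w (- u) = - dotv w u.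
Proof. by rewrite !(dotvC w) dotvNl. Qed.

Lemma dotv0l w : dotv 0 w = 0.
Proof. by rewrite -(scale0r w) dotvZl mul0r. Qed.

Lemma dotv_suml (I : Type) (r : seq I) (F : I -> 'cV[R]_3) w :
  dotv (\sum_(i <- r) F i) w = \sum_(i <- r) dotv (F i) w.
Proof.
by elim/big_rec2: _ => [|i c u _ <-]; [exact: dotv0l|exact: dotvDl].
Qed.

Lemma dotv_mulmxl M u v : dotv (M *m u) v = dotv u (M^T *m v).
Proof. by rewrite !dotvE trmx_mul mulmxA. Qed.

Lemma sqdistE u v : sqdist u v = dotv u u - 2 * dotv u v + dotv v v.
Proof. by rewrite /sqdist !(dotvDl, dotvDr, dotvNl, dotvNr) (dotvC v u); ring. Qed.

End Dot.

(** * Affine functions determined by their values at the microphones *)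

Section AffineInterpolation.
Variables (R : realType) (m : 'I_4 -> 'cV[R]_3).
Hypothesis ncop : ~ coplanar m.

(** Otherwise the zero set of the difference would be a plane through all four points. *)
Lemma affine_unique (u u' : 'cV[R]_3) (c c' : R) :
  (forall i, dotv u (m i) + c = dotv u' (m i) + c') -> u = u' /\ c = c'.
Proof.
move=> E; have uu' : u = u'.
  apply/eqP; rewrite -subr_eq0; apply/negPn/negP => nz; apply: ncop.
  exists [set x | dotv (u - u') x = c' - c]; first by exists (u - u'), (c' - c).
  move=> i /=; rewrite dotvDl dotvNl.
  by have := E i; move: (dotv u _) (dotv u' _) => p q; lra.
by split=> //; have := E 0; rewrite uu' => /addrI.
Qed.

(** [g k] and [g0 k] are the linear and constant parts of the k-th barycentric coordinate, which is
    1 at [m k] and 0 at the other points. They are read off the rows of an inverse matrix. *)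
Lemma affine_interp : exists (g : 'I_4 -> 'cV[R]_3) (g0 : 'I_4 -> R),
  forall (r : 'I_4 -> R) i,
    dotv (\sum_k r k *: g k) (m i) + \sum_k r k * g0 k = r i.
Proof.
pose M : 'M[R]_(3 + 1) := col_mx (\matrix_(j, i) m i j 0) (const_mx 1).
have mulME (v : 'rV[R]_(3 + 1)) i :
    (v *m M) 0 i = dotv (lsubmx v)^T (m i) + rsubmx v 0 0.
  rewrite -[v in LHS]hsubmxK mul_row_col [LHS]mxE; congr (_ + _).
    by rewrite mxE; apply: eq_bigr => j _; rewrite !mxE.
  by rewrite mxE big_ord1 [const_mx _ _ _]mxE mulr1.
have Munit : M \in unitmx.
  rewrite -row_free_unit; apply: inj_row_free => v vM0.
  have [|vl vr] := @affine_unique (lsubmx v)^T 0 (rsubmx v 0 0) 0.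
    by move=> i; rewrite -mulME vM0 mxE dotv0l addr0.
  rewrite -[v]hsubmxK -[lsubmx v]trmxK vl trmx0.
  suff -> : rsubmx v = 0 by rewrite row_mx0.
  by apply/rowP => j; rewrite ord1 vr mxE.
pose N := invmx M.
exists (fun k => (lsubmx (row k N))^T), (fun k => rsubmx (row k N) 0 0) => r i.
have gE k : dotv (lsubmx (row k N))^T (m i) + rsubmx (row k N) 0 0 = (k == i)%:R.
  by rewrite -mulME -row_mul mulVmx// !mxE.
rewrite dotv_suml -big_split (bigD1 i)//= big1 ?addr0 => [|k ki].
  by rewrite dotvZl -mulrDr gE eqxx mulr1.
by rewrite dotvZl -mulrDr gE (negbTE ki) mulr0.
Qed.

End AffineInterpolation.

Section VehicleMap.
Variable R : realType.
Implicit Types (c s : R) (x v w : 'cV[R]_3) (a : 'rV[R]_(2 * 2 + 3)).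

Definition linear_part a : 'M[R]_3 := block_mx (rotation_part a) 0 0 1%:M.

Lemma vehicle_mapE a v :
  vehicle_map a v = linear_part a *m v + translation_part a.
Proof. by []. Qed.

Lemma linear_part_orth a : vehicle_positions a ->
  linear_part a *m (linear_part a)^T = 1%:M.
Proof.
move=> [orth _]; rewrite /linear_part (tr_block_mx (rotation_part a)).
rewrite (@mulmx_block _ 2 1 2 1 2 1) orth !trmx0 !mul0mx !mulmx0 trmx1 mul1mx !addr0 add0r.
by rewrite -(@scalar_mx_block _ 2 1).
Qed.

Lemma linear_part_trK a v : vehicle_positions a ->
  linear_part a *m ((linear_part a)^T *m v) = v.
Proof. by move=> Ga; rewrite mulmxA linear_part_orth// mul1mx. Qed.

Lemma dotv_vehicle_map a x v :
  dotv x (vehicle_map a v) =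
  dotv ((linear_part a)^T *m x) v + dotv x (translation_part a).
Proof. by rewrite vehicle_mapE dotvDr dotv_mulmxl trmxK. Qed.

Definition i0 : 'I_3 := 0.
Definition i1 : 'I_3 := 1.

Lemma dotv3 x w : dotv x w =
  x i0 0 * w i0 0 + x i1 0 * w i1 0 + x ord_max 0 * w ord_max 0.
Proof.
rewrite /dotv !big_ord_recl big_ord0 addr0 addrA.
by congr (_ + _ * _ + _ * _); congr fun_of_matrix; apply: val_inj.
Qed.

Lemma dotv_linear_part_vpos c s x w v :
  dotv (linear_part (vpos c s x) *m w) v =
  (c * w i0 0 - s * w i1 0) * v i0 0 + (s * w i0 0 + c * w i1 0) * v i1 0
  + w ord_max 0 * v ord_max 0.
Proof.
rewrite /linear_part rotation_part_vpos.
have l0 : lshift 1 (0 : 'I_2) = i0 by apply: val_inj.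
have l1 : lshift 1 (1 : 'I_2) = i1 by apply: val_inj.
have r0 : rshift 2 (0 : 'I_1) = ord_max :> 'I_3 by apply: val_inj.
have m1 : lift 0 0 = 1 :> 'I_2 by apply: val_inj.
rewrite -[w in LHS](@vsubmxK _ 2 1) (@mul_block_col _ 2 1 2 1).
rewrite !mul0mx addr0 add0r mul1mx dotv3 -l0 -l1 -r0 !(@col_mxEu _ 2 1) (@col_mxEd _ 2 1).
rewrite !mxE !big_ord_recl !big_ord0 !m1 !mxE /= l0 l1 r0; ring.
Qed.

End VehicleMap.

(** * Elimination of the ghost point *)

Section GhostPolynomial.
Variables (R : realType) (m s g : 'I_4 -> 'cV[R]_3) (g0 : 'I_4 -> R).
Implicit Types (a : 'rV[R]_(2 * 2 + 3)) (x t : 'cV[R]_3).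
Hypothesis ncop : ~ coplanar m.
Hypothesis interp : forall (r : 'I_4 -> R) i,
  dotv (\sum_k r k *: g k) (m i) + \sum_k r k * g0 k = r i.

(** Squared distance from [s k] to the actual microphone k, less the squared norm of the microphone
    position, a term that also occurs for the ghost point. *)
Definition echo a k : R :=
  dotv (s k) (s k) - 2 * dotv (s k) (vehicle_map a (m k)).

Definition echo_lin a : 'cV[R]_3 := \sum_k echo a k *: g k.

Definition echo_cst a : R := \sum_k echo a k * g0 k.

(* A point [x] at distance |s k - m_k| from each microphone [m_k], with
   [m_k = A (m k) + t], satisfies |x|^2 - 2 x.m_k = echo a k. Comparing the two
   sides as affine functions of [m k] gives A^T x = - y / 2 and
   |x|^2 - 2 x.t = y0, where y = echo_lin a and y0 = echo_cst a; eliminating [x]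
   yields this polynomial. *)
Definition ghost_poly a : R :=
  4^-1 * dotv (echo_lin a) (echo_lin a)
  + dotv (linear_part a *m echo_lin a) (translation_part a) - echo_cst a.

Lemma ghost_poly_eq0 a x : vehicle_positions a ->
  (forall i, sqdist x (vehicle_map a (m i)) = sqdist (s i) (vehicle_map a (m i))) ->
  ghost_poly a = 0.
Proof.
move=> Ga dist.
have [yE y0E] : - 2 *: ((linear_part a)^T *m x) = echo_lin a /\
    dotv x x - 2 * dotv x (translation_part a) = echo_cst a.
  apply: (affine_unique ncop) => i; rewrite interp /echo dotvZl.
  have := dist i; rewrite !sqdistE => /addIr <-.
  by rewrite dotv_vehicle_map; ring.
rewrite /ghost_poly -yE -y0E -scalemxAr !(dotvZl, dotvZr) linear_part_trK//.
rewrite dotv_mulmxl trmxK linear_part_trK//.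
by field.
Qed.

Lemma polyfun_dotv (u v : 'rV[R]_(2 * 2 + 3) -> 'cV[R]_3) :
  (forall i, polyfun (fun a => u a i 0)) ->
  (forall i, polyfun (fun a => v a i 0)) -> polyfun (fun a => dotv (u a) (v a)).
Proof. by move=> pu pv; apply: polyfun_sum => i; exact: polyfunM. Qed.

Lemma polyfun_linear_part (u : 'rV[R]_(2 * 2 + 3) -> 'cV[R]_3) i :
  (forall i, polyfun (fun a => u a i 0)) ->
  polyfun (fun a => (linear_part a *m u a) i 0).
Proof.
move=> pu; under eq_fun do rewrite mxE.
apply: polyfun_sum => j; apply: polyfunM => //; rewrite /linear_part.
case: (@split_ordP 2 1 i) => i' ->; case: (@split_ordP 2 1 j) => j' ->.
- under eq_fun do rewrite (@block_mxEul _ 2 1 2 1); exact: polyfun_rotation.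
- under eq_fun do rewrite (@block_mxEur _ 2 1 2 1); exact: polyfun_cst.
- under eq_fun do rewrite (@block_mxEdl _ 2 1 2 1); exact: polyfun_cst.
- under eq_fun do rewrite (@block_mxEdr _ 2 1 2 1); exact: polyfun_cst.
Qed.

Lemma polyfun_ghost_poly : polyfun ghost_poly.
Proof.
have pecho k : polyfun (fun a => echo a k).
  apply: polyfunB; first exact: polyfun_cst.
  apply: polyfunM; first exact: polyfun_cst.
  apply: polyfun_dotv => i; first exact: polyfun_cst.
  under eq_fun do rewrite vehicle_mapE mxE.
  apply: polyfunD; last exact: polyfun_translation.
  by apply: polyfun_linear_part => j; exact: polyfun_cst.
have plin i : polyfun (fun a => echo_lin a i 0).
  under eq_fun do rewrite /echo_lin summxE; apply: polyfun_sum => k.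
  by under eq_fun do rewrite mxE; apply: polyfunM => //; exact: polyfun_cst.
apply: polyfunB; last first.
  by apply: polyfun_sum => k; apply: polyfunM => //; exact: polyfun_cst.
apply: polyfunD.
  by apply: polyfunM; [exact: polyfun_cst|exact: polyfun_dotv].
apply: polyfun_dotv => i; last exact: polyfun_translation.
exact: polyfun_linear_part.
Qed.

Definition slope t : 'cV[R]_3 := \sum_k dotv (s k) t *: g k.

(** The linear part of the affine map that takes each [m k] to [s k]; [slope t] is its transpose
    applied to t. *)
Let C (i j : 'I_3) : R := \sum_k s k i 0 * g k j 0.

Lemma slopeE t j :
  slope t j 0 = C i0 j * t i0 0 + C i1 j * t i1 0 + C ord_max j * t ord_max 0.
Proof.
rewrite /slope summxE /C !mulr_suml -!big_split; apply: eq_bigr => k _.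
by rewrite mxE dotv3 /=; ring.
Qed.

(* The second difference in the translation [t] isolates the part of
   [ghost_poly] that is quadratic in [t]. *)
Lemma ghost_poly_quadratic (c d : R) t :
  ghost_poly (vpos c d t) + ghost_poly (vpos c d (- t))
    - 2 * ghost_poly (vpos c d 0) =
  2 * dotv (slope t) (slope t)
    - 4 * dotv (linear_part (vpos c d 0) *m slope t) t.
Proof.
have lpE x : linear_part (vpos c d x) = linear_part (vpos c d 0).
  by rewrite /linear_part !rotation_part_vpos.
have echoE x k : echo (vpos c d x) k = echo (vpos c d 0) k - 2 * dotv (s k) x.
  rewrite /echo !vehicle_mapE !translation_part_vpos lpE addr0 dotvDr.
  by ring.
have linE x : echo_lin (vpos c d x) = echo_lin (vpos c d 0) - 2 *: slope x.
  rewrite /echo_lin /slope scaler_sumr -sumrB; apply: eq_bigr => k _.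
  by rewrite echoE scalerBl scalerA.
have slopeN : slope (- t) = - slope t.
  by rewrite /slope -sumrN; apply: eq_bigr => k _; rewrite dotvNr scaleNr.
have cstE x : echo_cst (vpos c d x) =
    echo_cst (vpos c d 0) - 2 * \sum_k dotv (s k) x * g0 k.
  rewrite /echo_cst mulr_sumr -sumrB; apply: eq_bigr => k _.
  by rewrite echoE mulrBl mulrA.
have cstN : \sum_k dotv (s k) (- t) * g0 k = - \sum_k dotv (s k) t * g0 k.
  by rewrite -sumrN; apply: eq_bigr => k _; rewrite dotvNr mulNr.
rewrite /ghost_poly (linE t) (linE (- t)) (cstE t) (cstE (- t)) cstN slopeN.
rewrite !translation_part_vpos (lpE t) (lpE (- t)).
move: (echo_lin _) (echo_cst _) (slope t) (linear_part _) => y y0 w A.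
rewrite scalerN opprK mulmxBr mulmxDr -!scalemxAr (dotvC _ 0) dotv0l.
rewrite !(dotvDl, dotvDr, dotvZl, dotvZr, dotvNl, dotvNr) (dotvC w y).
by field.
Qed.

(* Testing the quadratic part against the rotations by multiples of a right angle
   and a few translations leaves only the zz-entry of [C], with values 0 or 2. *)
Lemma ghost_poly_vanish : (forall a, vehicle_positions a -> ghost_poly a = 0) ->
  (forall i j, s i = s j) \/
  exists p, forall i, s i = p + (2 * zcoord (m i)) *: e_z R.
Proof.
move=> vanish.
have Q (c d : R) t : c ^+ 2 + d ^+ 2 = 1 ->
    dotv (slope t) (slope t) = 2 * dotv (linear_part (vpos c d 0) *m slope t) t.
  move=> cd; have := ghost_poly_quadratic c d t.
  rewrite !vanish; try exact: vehicle_positions_vpos.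
  by rewrite mulr0 subr0 addr0 => E; lra.
(* Comparing the four rotations separates the coefficient of the cosine, that of the sine, and the
   remaining part. *)
have H t : [/\ slope t i0 0 * t i0 0 + slope t i1 0 * t i1 0 = 0,
    slope t i0 0 * t i1 0 - slope t i1 0 * t i0 0 = 0
    & slope t i0 0 ^+ 2 + slope t i1 0 ^+ 2 + slope t ord_max 0 ^+ 2 =
      2 * slope t ord_max 0 * t ord_max 0].
  have := Q 1 0 t; have := Q (-1) 0 t; have := Q 0 1 t; have := Q 0 (-1) t.
  rewrite !dotv_linear_part_vpos dotv3 -!expr2.
  rewrite sqrrN expr1n expr0n /= addr0 add0r.
  move: (slope t i0 0) (slope t i1 0) (slope t ord_max 0) => w0 w1 w2.
  move: (t i0 0) (t i1 0) (t ord_max 0) => t0 t1 t2.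
  move=> /(_ erefl) E1 /(_ erefl) E2 /(_ erefl) E3 /(_ erefl) E4.
  by split; lra.
pose vec (x y z : R) : 'cV[R]_3 := x *: delta_mx i0 0 + y *: delta_mx i1 0 + z *: e_z R.
have vec0 p q r : vec p q r i0 0 = p by rewrite !mxE /=; ring.
have vec1 p q r : vec p q r i1 0 = q by rewrite !mxE /=; ring.
have vec2 p q r : vec p q r ord_max 0 = r by rewrite !mxE /=; ring.
(* The three basis vectors settle everything but the entries [C ord_max i0] and [C ord_max i1], for
   which the mixed translation is added. *)
have [] := H (vec 1 0 0); have [] := H (vec 0 1 0); have [] := H (vec 0 0 1).
have [] := H (vec 1 0 1).
rewrite !slopeE !vec0 !vec1 !vec2 !(mulr0, mulr1, addr0, add0r).
move=> C20 C21 _ _ _ C22 C11 C10 C12 C00 C01 C02.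
have sqr0 (z : R) : z ^+ 2 = 0 -> z = 0 by move=> /eqP; rewrite sqrf_eq0 => /eqP.
have {}C01 : C i0 i1 = 0 by apply/eqP; rewrite -oppr_eq0 C01.
have {}C10 : C i1 i0 = 0 by rewrite -[LHS]subr0.
have {}C20 : C ord_max i0 = 0 by move: C20; rewrite C00 add0r.
have {}C21 : C ord_max i1 = 0.
  by apply/eqP; rewrite -oppr_eq0; move: C21; rewrite C01 add0r => ->.
have {}C02 : C i0 ord_max = 0.
  by apply: sqr0; move: C02; rewrite C00 C01 expr0n !add0r.
have {}C12 : C i1 ord_max = 0.
  by apply: sqr0; move: C12; rewrite C10 C11 expr0n !add0r.
have {}C22 : C ord_max ord_max * (C ord_max ord_max - 2) = 0.
  by move: C22; rewrite C20 C21 expr0n !add0r mulrBr -expr2 => ->; ring.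
have sE i : s i = \sum_k g0 k *: s k + (C ord_max ord_max * zcoord (m i)) *: e_z R.
  have sij j : s i j 0 = C j i0 * m i i0 0 + C j i1 * m i i1 0 +
      C j ord_max * m i ord_max 0 + (\sum_k g0 k *: s k) j 0.
    rewrite -(interp (fun k => s k j 0)) dotv3 !summxE; congr (_ + _).
      by congr (_ * _ + _ * _ + _ * _); apply: eq_bigr => k _; rewrite mxE.
    by apply: eq_bigr => k _; rewrite mxE mulrC.
  have ordP (j : 'I_3) : [\/ j = i0, j = i1 | j = ord_max].
    by case: j => -[|[|[|//]]] ?; [apply: Or31|apply: Or32|apply: Or33];
      exact: val_inj.
  apply/colP => j; rewrite sij [RHS]mxE addrC; congr (_ + _).
  rewrite !mxE /zcoord; case: (ordP j) => ->.
  - by rewrite C00 C01 C02 !mul0r !addr0 mulr0.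
  - by rewrite C10 C11 C12 !mul0r !addr0 mulr0.
  - by rewrite C20 C21 !mul0r !add0r mulr1.
move/eqP: C22; rewrite mulf_eq0 subr_eq0 => /orP[]/eqP C22; [left|right].
  by move=> i j; rewrite sE [RHS]sE C22 !mul0r.
by exists (\sum_k g0 k *: s k) => i; rewrite {1}sE C22.
Qed.

End GhostPolynomial.

(** * Vanishing of the Cayley-Menger determinant *)

Section CayleyMenger.
Variable R : realType.

Lemma det_mulmx_lt (n k : nat) (X : 'M[R]_(n, k)) (Y : 'M[R]_(k, n)) :
  (k < n)%N -> \det (X *m Y) = 0.
Proof.
move=> kn; apply/eqP; rewrite -[_ == 0]negbK -unitfE -unitmxE -row_full_unit.
rewrite /row_full neq_ltn (leq_ltn_trans _ kn)//.
exact: leq_trans (mxrankM_maxr _ _) (rank_leq_row _).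
Qed.

(* |x - y|^2 = |x|^2 - 2 x.y + |y|^2 pairs vectors of length 5, so the 6 x 6
   Cayley-Menger matrix of five points has rank at most 5. *)
Lemma f_D_sqdist (m : 'I_4 -> 'cV[R]_3) (s : 'cV[R]_3) :
  f_D m (fun i => sqdist s (m i)) = 0.
Proof.
pose P : 'M[R]_(4, 3) := \matrix_(i, j) m i j 0.
pose q : 'cV[R]_4 := \col_i dotv (m i) (m i).
(* For p among s and the [m i], the rows of X are (|p|^2, p, 1) and the columns of Y are (1, -2 p,
   |p|^2). The extra row (1, 0, 0) and column (0, 0, 1) produce the border of ones. *)
pose X : 'M[R]_(1 + (4 + 1), 1 + (3 + 1)) :=
  col_mx (row_mx (dotv s s)%:M (row_mx s^T 1%:M))
    (col_mx (row_mx q (row_mx P (const_mx 1))) (row_mx 1%:M (row_mx 0 0))).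
pose Y : 'M[R]_(1 + (3 + 1), 1 + (4 + 1)) :=
  row_mx (col_mx 1%:M (col_mx (- 2 *: s) (dotv s s)%:M))
    (row_mx (col_mx (const_mx 1) (col_mx (- 2 *: P^T) q^T))
       (col_mx 0 (col_mx 0 1%:M))).
have mulPT (M : 'rV[R]_3) j : (M *m P^T) 0 j = dotv M^T (m j).
  by rewrite mxE; apply: eq_bigr => k _; rewrite !mxE.
have mulP i (v : 'cV[R]_3) : (P *m v) i 0 = dotv (m i) v.
  by rewrite mxE; apply: eq_bigr => k _; rewrite !mxE.
have PPT i j : (P *m P^T) i j = dotv (m i) (m j).
  by rewrite mxE; apply: eq_bigr => k _; rewrite !mxE.
rewrite /f_D (_ : block_mx _ _ _ _ = X *m Y) ?det_mulmx_lt//.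
rewrite /X /Y mul_col_row !mul_mx_row !mul_col_mx !mul_row_col.
rewrite !(mul0mx, mulmx0, mul1mx, mulmx1, addr0, add0r) -!scalemxAr.
have -> : (1%:M : 'M[R]_1) = const_mx 1.
  by apply/matrixP => i j; rewrite !ord1 !mxE.
rewrite -block_mxEh; congr block_mx.
- apply/matrixP => i j; rewrite !ord1 [LHS]mxE mxE [X in _ = _ + X]mxE.
  by rewrite [X in _ = _ + (X + _)]mxE -dotvE !mxE eqxx mulr1n; ring.
- congr row_mx; apply/rowP => j.
  rewrite [LHS]mxE sqdistE mxE [X in _ = _ + X]mxE [X in _ = _ + (X + _)]mxE mulPT trmxK.
  by rewrite mul_scalar_mx !mxE; ring.
- congr col_mx; apply/colP => i.
  rewrite [LHS]mxE sqdistE mxE [X in _ = _ + X]mxE [X in _ = _ + (X + _)]mxE mulP.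
  by rewrite mul_mx_scalar !mxE (dotvC s); ring.
- congr block_mx; apply/matrixP => i j.
  rewrite [LHS]mxE sqdistE mxE [X in _ = _ + X]mxE [X in _ = _ + (X + _)]mxE PPT.
  by rewrite !mxE !big_ord1 !mxE; ring.
Qed.

End CayleyMenger.

(** * Bad vehicle positions *)

Section GoodPositions.
Variables (R : realType) (m : 'I_4 -> 'cV[R]_3).
Hypothesis ncop : ~ coplanar m.
Implicit Types (a : 'rV[R]_(2 * 2 + 3)).

(** Once the squared norms of the microphone positions cancel, both sides are affine in [m i]. By
    [affine_unique] the images of x and x' under the transposed linear part agree, and that matrix
    is orthogonal. *)
Lemma sqdist_vehicle_inj a (x x' : 'cV[R]_3) : vehicle_positions a ->
  (forall i, sqdist x (vehicle_map a (m i)) = sqdist x' (vehicle_map a (m i))) ->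
  x = x'.
Proof.
move=> Ga E.
have [xx' _] : - 2 *: ((linear_part a)^T *m x) = - 2 *: ((linear_part a)^T *m x') /\
    dotv x x - 2 * dotv x (translation_part a) =
    dotv x' x' - 2 * dotv x' (translation_part a).
  apply: (affine_unique ncop) => i; have := E i; rewrite !sqdistE => /addIr.
  by rewrite !dotv_vehicle_map !dotvZl => {}E; lra.
have /scalerI/(congr1 (mulmx (linear_part a))) := xx'.
by rewrite !linear_part_trK// => -> //; rewrite oppr_eq0 pnatr_eq0.
Qed.

(** Shows that a wall heard by all microphones is never missed, so that only ghost walls can spoil a
    position. *)
Lemma algorithm_outputs_mirror L heard a W : vehicle_positions a ->
  (forall i, heard i W) ->
  algorithm_outputs L (fun i => vehicle_map a (m i)) heard (mirror L W).
Proof.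
move=> Ga hW; exists (fun i => sqdist (mirror L W) (vehicle_map a (m i))); split.
- by move=> i; exists W.
- exact: f_D_sqdist.
- by split=> // x' Ex'; apply: (sqdist_vehicle_inj Ga) => i; rewrite Ex'.
Qed.

Lemma bad_positions_thin L (walls : set (set 'cV[R]_3))
    (heard : 'rV[R]_(2 * 2 + 3) -> 'I_4 -> set (set 'cV[R]_3)) :
  finite_set walls ->
  (forall a i, vehicle_positions a -> heard a i `<=` walls) ->
  ~ unlucky_stack m [set mirror L W | W in walls] ->
  exists V : set 'rV[R]_(2 * 2 + 3),
    [/\ zariski_closed V, V `<=` @vehicle_positions R, dim_lt V 4
      & forall a, vehicle_positions a ->
          ~ good L walls (fun i => vehicle_map a (m i)) (heard a) -> V a].
Proof.
move=> finW heardW lucky.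
have [g [g0 interp]] := affine_interp ncop.
have /finite_seqP[ms msE] := finite_image (mirror L) finW.
pose s (j : {ffun 'I_4 -> 'I_(size ms)}) k : 'cV[R]_3 := tnth (in_tuple ms) (j k).
have sW j k : (mirror L @` walls) (s j k) by rewrite msE /=; exact: mem_tnth.
pose nonconst j := [exists k, s j k != s j 0].
(* The product runs over quadruples of mirror points of all walls, heard or not, so the exceptional
   set does not depend on [heard]. *)
pose F a := \prod_(j | nonconst j) ghost_poly m (s j) g g0 a.
have pF : polyfun F by apply: polyfun_prod => j; exact: polyfun_ghost_poly.
exists (@vehicle_positions R `&` [set a | F a = 0]).
have clG := @zariski_closed_vehicle_positions R.
have irrG := @irreducible_vehicle_positions R.
split.
- by apply: zariski_closedI => //; exact: zariski_closed_zero.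
- by move=> a [].
- apply: (dim_lt_proper clG irrG (@has_dim_vehicle_positions R)).
  split=> [a []//|GF].
  have [|a /GF[_ /= Fa]|j [_ /existsP[k /eqP ncj] vanish]] :=
      irreducible_prod (s := index_enum _) (P := nonconst)
      (f := fun j => ghost_poly m (s j) g g0) irrG.
  + by move=> j; exact: polyfun_ghost_poly.
  + exact: Fa.
  + have [cst|[p sE]] := ghost_poly_vanish interp vanish.
      exact/ncj/cst.
    apply: lucky; exists (s j); split=> //.
      by exists p => i; exists (2 * zcoord (m i)).
    move=> i l; rewrite !sE /zcoord !mxE /=; ring.
- move=> a Ga /not_andP[|]; first by case=> W; exact: algorithm_outputs_mirror.
  move=> /contrapT[x [[d [dD _ [xd _]]] xW]]; split=> //=.
  have /choice[W HW] : forall i, exists W, heard a i W /\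
      sqdist (mirror L W) (vehicle_map a (m i)) = d i.
    by move=> i; have [W hW <-] := dD i; exists W.
  have /choice[j jE] : forall i, exists j : 'I_(size ms),
      tnth (in_tuple ms) j = mirror L (W i).
    move=> i; have [hW _] := HW i.
    have : [set` ms] (mirror L (W i)).
      by rewrite -msE; exists (W i) => //; exact: heardW hW.
    move=> /= /(nthP 0)[k kms <-]; exists (Ordinal kms).
    by rewrite (tnth_nth 0).
  pose J := [ffun i => j i].
  have sJ i : s J i = mirror L (W i) by rewrite /s ffunE.
  have dist i : sqdist x (vehicle_map a (m i)) = sqdist (s J i) (vehicle_map a (m i)).
    by rewrite xd sJ; have [_ ->] := HW i.
  (* If the quadruple were constant, x would have the same distances as one mirror point, hence
     equal it, and would not be a ghost. *)
  rewrite /F (bigD1 J)/=; last first.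
    apply: contrapT => /negP/existsPn cst; apply: xW.
    exists (W 0); first by have [hW _] := HW 0; exact: heardW hW.
    rewrite -sJ; apply: (sqdist_vehicle_inj Ga) => i; rewrite dist.
    by have /negPn/eqP -> := cst i.
  by rewrite (ghost_poly_eq0 ncop interp Ga dist) mul0r.
Qed.

End GoodPositions.

(** * Unlucky arrangements *)

Section UnluckyArrangements.
Variables (R : realType) (n : nat).

Definition mirror_point (x : 'rV[R]_(3 * n)) (k : 'I_n) : 'cV[R]_3 :=
  col k (vec_mx x : 'M[R]_(3, n)).

Lemma polyfun_mirror_point k i :
  polyfun (fun x : 'rV[R]_(3 * n) => mirror_point x k i 0).
Proof. by under eq_fun do rewrite !mxE; exact: polyfun_coord. Qed.

(* The points [j h], [h != 0], are determined by the point [j 0]; the other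
   points are free. *)
Lemma translate_flat (l : nat) (j : 'I_l.+1 -> 'I_n) (b : 'I_l.+1 -> 'cV[R]_3) :
  injective j -> b 0 = 0 ->
  let A := [set x | forall h, mirror_point x (j h) = mirror_point x (j 0) + b h] in
  zariski_closed A /\ has_dim A (3 * (n - l)).
Proof.
move=> j_inj b0 A.
(* [D] holds the indices of the free columns, among them [j 0]. *)
pose D := (~: (j @: [set~ 0]))%SET.
have j0D : j 0 \in D.
  rewrite inE; apply/imsetP => -[h]; rewrite in_setC1 => h0 /j_inj h0'.
  by case/eqP: h0; rewrite -h0'.
have jD h : h != 0 -> j h \notin D.
  by move=> h0; rewrite inE negbK; apply: imset_f; rewrite !inE.
have DjP k : k \notin D -> exists2 h, h != 0 & k = j h.
  by rewrite inE negbK => /imsetP[h]; rewrite !inE => h0 ->; exists h.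
have cardD : #|D| = (n - l)%N.
  by rewrite cardsCs finset.setCK card_imset// cardsC1 !card_ord.
(* Column k is a copy of free column [f k] shifted by [off k]; a determined column is copied from
   column [j 0]. *)
pose f k : 'I_#|D| := enum_rank_in j0D (if k \in D then k else j 0).
pose g (c : 'I_#|D|) : 'I_n := enum_val c.
have gf k : g (f k) = if k \in D then k else j 0.
  by rewrite /g /f; case: ifP => kD; rewrite enum_rankK_in.
have fg c : f (g c) = c by rewrite /g /f enum_valP enum_valK_in.
pose off k := if [pick h | j h == k] is Some h then b h else 0.
have offj h : off (j h) = b h.
  by rewrite /off; case: pickP => [h' /eqP/j_inj->//|/(_ h)]; rewrite eqxx.
have offD k : k \in D -> off k = 0.
  rewrite /off; case: pickP => // h /eqP <- hD.
  by have [->//|/jD] := eqVneq h 0; rewrite hD.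
pose phi (y : 'rV[R]_(3 * #|D|)) : 'rV[R]_(3 * n) :=
  mxvec (\matrix_(i, k) ((vec_mx y : 'M_(3, #|D|)) i (f k) + off k i 0)).
pose psi (x : 'rV[R]_(3 * n)) : 'rV[R]_(3 * #|D|) :=
  mxvec (\matrix_(i, c) mirror_point x (g c) i 0).
have phiE y k i : mirror_point (phi y) k i 0 =
    (vec_mx y : 'M_(3, #|D|)) i (f k) + off k i 0.
  by rewrite /mirror_point mxE mxvecK mxE.
have phiK : cancel phi psi.
  move=> y; rewrite -[RHS]vec_mxK; congr mxvec; apply/matrixP => i c.
  by rewrite mxE phiE fg offD ?enum_valP// [X in _ + X]mxE addr0.
have pphi : polymap phi.
  move=> ik; case/mxvec_indexP: ik => i k; under eq_fun do rewrite mxvecE !mxE.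
  by apply: polyfunD; [exact: polyfun_coord|exact: polyfun_cst].
have ppsi : polymap psi.
  move=> ic; case/mxvec_indexP: ic => i c; under eq_fun do rewrite mxvecE mxE.
  exact: polyfun_mirror_point.
have -> : A = range phi.
  apply/seteqP; split=> [x Ax|_ [y _ <-] h]; last first.
    apply/colP => i; rewrite [RHS]mxE !phiE !offj b0 [(0 : 'cV_3) _ _]mxE addr0.
    congr (_ + _); have [->//|h0] := eqVneq h 0.
    by rewrite /f (negbTE (jD h h0)) j0D.
  exists (psi x) => //; rewrite -[RHS]vec_mxK; congr mxvec.
  apply/matrixP => i k; rewrite [LHS]mxE /psi mxvecK [X in X + _]mxE gf.
  have xE k' : (vec_mx x : 'M_(3, n)) i k' = mirror_point x k' i 0.
    by rewrite [RHS]mxE.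
  case: ifPn => [kD|/DjP[h h0 ->]]; first by rewrite offD// [X in _ + X]mxE addr0 xE.
  by rewrite offj xE (Ax h) [RHS]mxE.
have [cl _ dim] := has_dim_retract pphi ppsi phiK.
by rewrite -cardD.
Qed.

(** One microphone is picked for each height. Different heights force different mirror points, hence
    different indices. The heights [z] are chosen before [x], so only finitely many flats arise. *)
Lemma unlucky_heights (m : 'I_4 -> 'cV[R]_3) (l : nat) : num_heights m = l.+1 ->
  exists z : 'I_l.+1 -> R, forall x, unlucky_arrangements m x ->
    exists2 j : 'I_l.+1 -> 'I_n, injective j &
      forall h, mirror_point x (j h) =
        mirror_point x (j 0) + (2 * (z h - z 0)) *: e_z R.
Proof.
rewrite /num_heights; set hs := undup _ => size_hs.
have /choice[r rE] : forall h : 'I_l.+1, exists i, zcoord (m i) = nth 0 hs h.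
  move=> h; have : nth 0 hs h \in hs by rewrite mem_nth// size_hs.
  by rewrite mem_undup => /mapP[i _ ->]; exists i.
exists (fun h => nth 0 hs h) => x [s [sx [p sp] sz]].
have /choice[t tE] := sp.
have /choice[J JE] : forall i, exists k, mirror_point x k = s i.
  by move=> i; have [k _ <-] := sx i; exists k.
have zE i k : t i - t k = 2 * (zcoord (m i) - zcoord (m k)).
  have := sz k i; rewrite !tE /zcoord !mxE /= !mulr1 => <-; ring.
exists (fun h => J (r h)) => [h h' Jhh'|h]; last first.
  by rewrite !JE !tE -!rE -zE scalerBl -addrA [X in _ = _ + X]addrC subrK.
apply/val_inj/eqP; rewrite -(@nth_uniq _ 0 hs) ?size_hs ?ltn_ord ?undup_uniq//.
rewrite -!rE -subr_eq0.
have /eqP : 2 * (zcoord (m (r h)) - zcoord (m (r h'))) = 0.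
  rewrite -zE; have : s (r h) = s (r h') by rewrite -!JE Jhh'.
  rewrite !tE => /addrI /(congr1 (fun v : 'cV_3 => v ord_max 0)).
  by rewrite !mxE /= !mulr1 => ->; rewrite subrr.
by rewrite mulf_eq0 pnatr_eq0.
Qed.

Lemma unlucky_arrangements_codim (m : 'I_4 -> 'cV[R]_3) :
  if (n < num_heights m)%N then @unlucky_arrangements R m n = set0
  else exists V : set 'rV[R]_(3 * n),
    [/\ zariski_closed V, has_codim V setT (3 * (num_heights m).-1)%N
      & @unlucky_arrangements R m n `<=` V].
Proof.
(* From here on [l] is one less than the number of heights, so the codimension to reach is 3 * l. *)
have [l lE] : exists l, num_heights m = l.+1.
  suff : num_heights m != 0%N by case: (num_heights m) => // l; exists l.
  rewrite -lt0n -has_predT; apply/hasP; exists (zcoord (m 0)) => //.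
  by rewrite mem_undup; apply/mapP; exists 0 => //; rewrite mem_enum.
have [z zP] := unlucky_heights lE; rewrite lE; case: ltnP => nl.
  apply/seteqP; split=> // x /zP[j j_inj _].
  by have := leq_card j j_inj; rewrite !card_ord leqNgt nl.
pose A (j : {ffun 'I_l.+1 -> 'I_n}) : set 'rV[R]_(3 * n) :=
  [set x | forall h, mirror_point x (j h) =
     mirror_point x (j 0) + (2 * (z h - z 0)) *: e_z R].
have clA j : zariski_closed (A j).
  have -> : A j = [set x | forall hi, setT hi -> mirror_point x (j hi.1) hi.2 0 -
      (mirror_point x (j 0) hi.2 0 + ((2 * (z hi.1 - z 0)) *: e_z R) hi.2 0) = 0].
    apply/seteqP; split=> x /= Ax.
      by move=> [h i] _ /=; rewrite Ax [X in X - _]mxE subrr.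
    move=> h; apply/colP => i; apply/eqP; rewrite -subr_eq0 [X in _ - X]mxE.
    by rewrite (Ax (h, i)).
  apply: zariski_closed_zeros => -[h i] /=.
  apply: polyfunB; first exact: polyfun_mirror_point.
  by apply: polyfunD; [exact: polyfun_mirror_point|exact: polyfun_cst].
have dimA (j : {ffun 'I_l.+1 -> 'I_n}) : injectiveb j -> has_dim (A j) (3 * (n - l)).
  move=> /injectiveP j_inj.
  have [|] := @translate_flat l j (fun h => (2 * (z h - z 0)) *: e_z R) j_inj.
    by rewrite subrr mulr0 scale0r.
  by [].
exists [set x | exists2 j : {ffun 'I_l.+1 -> 'I_n}, injectiveb j & A j x]; split.
- exact: zariski_closed_bigU.
- exists (3 * (n - l))%N, (3 * n)%N; split.
  + apply: has_dim_bigU => //.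
    (* At least one injective choice exists, so the union attains the dimension of its members. *)
    exists [ffun h => widen_ord nl h]; apply/injectiveP => h h'; rewrite !ffunE.
    by move=> /(congr1 val) /= /val_inj.
  + exact: has_dimT.
  + by rewrite /= -mulnDr subnK// ltnW.
- move=> x /zP[j j_inj jE]; exists [ffun h => j h].
    by apply/injectiveP => h h'; rewrite !ffunE => /j_inj.
  by move=> h; rewrite !ffunE.
Qed.

End UnluckyArrangements.

Unset Implicit Arguments.
Set Strict Implicit.
Set Printing Implicit Defensive.

Theorem theorem3p2 (R : realType) (m_ini : 'I_4 -> 'cV[R]_3)
    (L : 'cV[R]_3) (n : nat) (hm : ~ coplanar m_ini) :
  has_dim (@vehicle_positions R) 4 /\
  (forall (walls : set (set 'cV[R]_3))
          (heard : 'rV[R]_(2 * 2 + 3) -> 'I_4 -> set (set 'cV[R]_3)),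
      (walls #= `I_n)%card ->
      (forall W, walls W -> is_plane W) ->
      (forall a i, vehicle_positions a -> heard a i `<=` walls) ->
      ~ unlucky_stack m_ini [set mirror L W | W in walls] ->
      exists V : set 'rV[R]_(2 * 2 + 3),
        [/\ zariski_closed V,
            V `<=` @vehicle_positions R,
            dim_lt V 4
          & forall a, vehicle_positions a ->
              ~ good L walls (fun i => vehicle_map a (m_ini i)) (heard a) ->
              V a]) /\
  (if (n < num_heights m_ini)%N then @unlucky_arrangements R m_ini n = set0
   else exists V : set 'rV[R]_(3 * n),
       [/\ zariski_closed V,
           has_codim V setT (3 * (num_heights m_ini).-1)%N
         & @unlucky_arrangements R m_ini n `<=` V]).
Proof.
split; first exact: has_dim_vehicle_positions.
split; last exact: unlucky_arrangements_codim.
move=> walls heard cardW _ heardW lucky.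
by apply: bad_positions_thin => //; exists n.
Qed.
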